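(* Let $\Bbbk$ be an algebraically closed field of characteristic $p>2$ and let $D(H)$ be the Drinfeld double of the bosonization $H$ of the restricted Jordan plane. The subalgebra $\mathbf R$ of $D(H)$ generated by $g$, $x$ and $u$ is a normal local commutative Hopf subalgebra of $D(H)$ of dimension $p^3$ with defining relations (as a commutative algebra) $$g^p=1,\qquad x^p=0,\qquad u^p=0 .$$ It gives rise to an exact sequence of Hopf algebras $$\mathbf R\hookrightarrow D(H)\twoheadrightarrow\mathfrak u(\mathfrak{sl}_2(\Bbbk)),$$ whose first map is the inclusion.
   Context: $H$ is the $p^3$-dimensional Hopf algebra generated by $x,y,g$ with relations $g^p=1$, $gx=xg$, $gy=yg+xg$, $x^p=0$, $y^p=0$, $yx=xy-\frac12x^2$ and coproduct $\Delta(g)=g\otimes g$, $\Delta(x)=x\otimes1+g\otimes x$, $\Delta(y)=y\otimes1+g\otimes y$. Its Drinfeld double $D(H)$, of dimension $p^6$, is the Hopf algebra presented by generators $u,v,\zeta,g,x,y$ and relations \begin{align*} & g^p=1,\ gx=xg,\ gy=yg+xg,\ x^p=0,\ y^p=0,\ yx=xy-\tfrac12x^2,\ \zeta^p=\zeta,\ g\zeta=\zeta g,\\ & v^p=0,\ u^p=0,\ vu=uv-\tfrac12u^2,\ v\zeta=\zeta v+v,\ u\zeta=\zeta u+u,\\ & \zeta y=y\zeta+y,\ \zeta x=x\zeta+x,\ vg=gv+gu,\ ug=gu,\ vx=xv+(1-g)+xu,\\ & ux=xu,\ uy=yu+(1-g),\ vy=yv-g\zeta+yu, \end{align*} with coproduct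 given on $g,x,y$ as in $H$ and $\Delta(\zeta)=\zeta\otimes1+1\otimes\zeta$, $\Delta(u)=u\otimes1+1\otimes u$, $\Delta(v)=v\otimes1+1\otimes v+\zeta\otimes u$. $\mathfrak u(\mathfrak{sl}_2(\Bbbk))$ is the restricted enveloping algebra of $\mathfrak{sl}_2(\Bbbk)$ (of dimension $p^3$). A sequence of Hopf algebra maps $A\xrightarrow{\iota}C\xrightarrow{\pi}B$ is exact if $\iota$ is injective, $\pi$ is surjective, $\ker\pi=C\iota(A)^+$ (where $A^+=\ker\varepsilon$) and $\iota(A)=C^{\mathrm{co}\,\pi}=\{c\in C:(\mathrm{id}\otimes\pi)\Delta(c)=c\otimes1\}$. Normal Hopf subalgebra means stable under the adjoint actions. *)

(* Defs.v *)
From HB Require Import structures.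
From mathcomp Require Import all_boot all_order all_algebra all_field.

Set Implicit Arguments.
Unset Strict Implicit.
Unset Printing Implicit Defensive.

Import GRing.Theory VectorInternalTheory.
Local Open Scope ring_scope.

(* A (x) B is realised by matrices of coordinates in the coordinate bases of
   A and B; [tlift] extracts from a map that is bilinear the associated linear
   map on A (x) B (lemma [tliftE]), so that the construction does not depend on
   the bases up to canonical isomorphism. *)

Definition cbase (k : fieldType) (V : vectType k) (i : 'I_(dim V)) : V :=
  r2v (delta_mx 0 i).

Definition tensor (k : fieldType) (A B : vectType k) : Type :=
  'M[k]_(dim A, dim B).

HB.instance Definition _ (k : fieldType) (A B : vectType k) :=
  Vector.copy (tensor A B) 'M[k]_(dim A, dim B).

Definition pure (k : fieldType) (A B : vectType k) (a : A) (b : B) :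
    tensor A B :=
  (v2r a)^T *m v2r b.

Notation "a ⊗ b" := (pure a b) (at level 40, left associativity) : ring_scope.

Definition tlift (k : fieldType) (A B : vectType k) (V : lmodType k)
    (f : A -> B -> V) (t : tensor A B) : V :=
  \sum_i \sum_j (t : 'M_(_, _)) i j *: f (cbase i) (cbase j).

Definition bilinear_map (k : fieldType) (A B V : lmodType k)
    (f : A -> B -> V) : Prop :=
  (forall a, linear (f a)) /\ (forall b, linear (f^~ b)).

Section TensorTheory.
Variables (k : fieldType) (A B : vectType k).
Implicit Types (t : tensor A B) (a : A) (b : B).

Lemma coord_cbase (V : vectType k) (v : V) :
  v = \sum_i v2r v 0 i *: cbase i.
Proof.
rewrite -[LHS]v2rK {1}[v2r v]row_sum_delta raddf_sum.
by apply: eq_bigr => i _; exact: linearZ.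
Qed.

Lemma linear_cbase (V : vectType k) (W : lmodType k) (h : V -> W) (v : V) :
  linear h -> h v = \sum_i v2r v 0 i *: h (cbase i).
Proof.
move=> hl; pose F := GRing.isLinear.Build k V W *:%R h hl.
pose g : {linear V -> W} := HB.pack h F.
rewrite -[h v]/(g v) {1}[v]coord_cbase linear_sum.
by apply: eq_bigr => i _; exact: (linearZZ g).
Qed.

Lemma pureE a b i j : (a ⊗ b : 'M_(_, _)) i j =
  v2r a 0 i * v2r b 0 j.
Proof. by rewrite /pure mxE big_ord1 mxE. Qed.

Lemma pure_bilinear : bilinear_map (@pure k A B).
Proof.
split=> [a c b b' | b c a a']; apply/matrixP=> i j;
  rewrite [RHS]mxE [X in _ = X + _]mxE !pureE linearP !mxE.
  by rewrite mulrDr mulrCA.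
by rewrite mulrDl mulrA.
Qed.

Lemma tlift_is_linear (V : lmodType k) (f : A -> B -> V) : linear (tlift f).
Proof.
move=> c t t'; rewrite /tlift scaler_sumr -big_split; apply: eq_bigr => i _ /=.
rewrite scaler_sumr -big_split; apply: eq_bigr => j _ /=.
by rewrite !mxE scalerDl scalerA.
Qed.
HB.instance Definition _ (V : lmodType k) (f : A -> B -> V) :=
  GRing.isLinear.Build k (tensor A B) V *:%R (tlift f) (tlift_is_linear f).

Lemma tliftE (V : lmodType k) (f : A -> B -> V) : bilinear_map f ->
  forall a b, tlift f (a ⊗ b) = f a b.
Proof.
move=> [fr fl] a b; rewrite (linear_cbase b (fr a)) /tlift exchange_big.
apply: eq_bigr => j _; rewrite (linear_cbase a (fl (cbase j))) scaler_sumr.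
by apply: eq_bigr => i _; rewrite scalerA pureE mulrC.
Qed.

Lemma tensor_sum t :
  t = \sum_i \sum_j (t : 'M_(_, _)) i j *: (cbase i ⊗ cbase j).
Proof.
rewrite {1}[t]matrix_sum_delta; apply: eq_bigr => i _; apply: eq_bigr => j _.
congr (_ *: _); apply/matrixP=> i' j'.
by rewrite pureE /cbase !r2vK !mxE !eqxx -natrM mulnb.
Qed.

Lemma tensor_ext (V : lmodType k) (f g : {linear tensor A B -> V}) :
  (forall a b, f (a ⊗ b) = g (a ⊗ b)) -> f =1 g.
Proof.
move=> fg t; rewrite [t]tensor_sum !linear_sum; apply: eq_bigr => i _.
rewrite !linear_sum; apply: eq_bigr => j _.
by rewrite (linearZZ f) (linearZZ g) fg.
Qed.

Lemma pure_neq0 a b : a != 0 -> b != 0 -> a ⊗ b != 0.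
Proof.
have v2r_neq0 (V : vectType k) (v : V) : v != 0 -> exists i, v2r v 0 i != 0.
  move=> v0; apply/rV0Pn; apply: contraNneq v0 => v0.
  by rewrite -[v]v2rK v0 linear0.
move=> /v2r_neq0[i ai] /v2r_neq0[j bj].
by apply/eqP=> /matrixP/(_ i j)/eqP; rewrite pureE mxE mulf_eq0 (negPf ai) (negPf bj).
Qed.

End TensorTheory.

Section TensorAlgebra.
Variables (k : fieldType) (A B : falgType k).
Local Notation T := (tensor A B).
Implicit Types (t : T) (a : A) (b : B).

Definition tmul (s t : T) : T :=
  tlift (fun a b => tlift (fun c d => (a * c) ⊗ (b * d)) t) s.

Fact tmul_pure_r a b :
  bilinear_map (fun (c : A) (d : B) => (a * c) ⊗ (b * d)).
Proof.
have [pr pl] := @pure_bilinear k A B; split=> [c z d d' | d z c c'].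
  by rewrite mulrDr -scalerAr pr.
by rewrite mulrDr -scalerAr pl.
Qed.

Fact tmul_pure_l t : bilinear_map
  (fun (a : A) (b : B) => tlift (fun c d => (a * c) ⊗ (b * d)) t).
Proof.
have [pr pl] := @pure_bilinear k A B.
split=> [a z b b' | b z a a']; rewrite /tlift scaler_sumr -big_split;
  apply: eq_bigr => i _ /=; rewrite scaler_sumr -big_split;
  apply: eq_bigr => j _ /=.
  by rewrite mulrDl -scalerAl pr scalerDr !scalerA mulrC.
by rewrite mulrDl -scalerAl pl scalerDr !scalerA mulrC.
Qed.

Lemma tmulE a b c d : tmul (a ⊗ b) (c ⊗ d) = (a * c) ⊗ (b * d).
Proof. by rewrite /tmul (tliftE (tmul_pure_l _)) (tliftE (tmul_pure_r _ _)). Qed.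

Fact tmulP_l t : linear (tmul^~ t).
Proof. exact: tlift_is_linear. Qed.
Fact tmulP_r s : linear (tmul s).
Proof.
move=> z t t'; rewrite /tmul {1 3 5}/tlift scaler_sumr -big_split.
apply: eq_bigr => i _ /=; rewrite scaler_sumr -big_split.
by apply: eq_bigr => j _ /=; rewrite linearP scalerDr !scalerA mulrC.
Qed.

Let mull t : {linear T -> T} :=
  HB.pack (tmul^~ t) (GRing.isLinear.Build k T T *:%R (tmul^~ t) (tmulP_l t)).
Let mulr s : {linear T -> T} :=
  HB.pack (tmul s) (GRing.isLinear.Build k T T *:%R (tmul s) (tmulP_r s)).

Let tmulA : associative tmul.
Proof.
move=> r s t.
apply: (tensor_ext (f := mull (tmul s t)) (g := mull t \o mull s)) => a b /=.
apply: (tensor_ext (f := mulr (a ⊗ b) \o mull t) (g := mull t \o mulr (a ⊗ b))) => c d /=.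
apply: (tensor_ext (f := mulr (a ⊗ b) \o mulr (c ⊗ d)) (g := mulr (tmul (a ⊗ b) (c ⊗ d)))) => e f /=.
by rewrite !tmulE !mulrA.
Qed.

Let tmul1l : left_id (1 ⊗ 1) tmul.
Proof.
by apply: (tensor_ext (f := mulr (1 ⊗ 1)) (g := idfun)) => a b /=; rewrite tmulE !mul1r.
Qed.

Let tmul1r : right_id (1 ⊗ 1) tmul.
Proof.
by apply: (tensor_ext (f := mull (1 ⊗ 1)) (g := idfun)) => a b /=; rewrite tmulE !mulr1.
Qed.

Let tmulDl : left_distributive tmul +%R.
Proof. by move=> r s t; apply: (linearD (mull t)). Qed.
Let tmulDr : right_distributive tmul +%R.
Proof. by move=> r s t; apply: (linearD (mulr r)). Qed.
Let t1_neq0 : (1 : A) ⊗ (1 : B) != 0.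
Proof. by apply: pure_neq0; apply: oner_neq0. Qed.

HB.instance Definition _ := GRing.Zmodule_isNzRing.Build T
  tmulA tmul1l tmul1r tmulDl tmulDr t1_neq0.

Fact tensor_scaleAl z (s t : T) : z *: (s * t) = (z *: s) * t.
Proof. exact: esym (linearZZ (mull t) z s). Qed.
HB.instance Definition _ := GRing.Lmodule_isLalgebra.Build k T tensor_scaleAl.

Fact tensor_scaleAr z (s t : T) : z *: (s * t) = s * (z *: t).
Proof. exact: esym (linearZZ (mulr s) z t). Qed.
HB.instance Definition _ := GRing.Lalgebra_isAlgebra.Build k T tensor_scaleAr.
HB.instance Definition _ := Algebra_isFalgebra.Build k T.

Lemma tensor1E : 1 = 1 ⊗ 1 :> T.
Proof. by []. Qed.

Lemma pureM a b c d : (a ⊗ b) * (c ⊗ d) = (a * c) ⊗ (b * d).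
Proof. exact: tmulE. Qed.

End TensorAlgebra.

Definition tmap (k : fieldType) (A B C D : vectType k)
    (f : A -> C) (g : B -> D) : tensor A B -> tensor C D :=
  tlift (fun a b => f a ⊗ g b).

Definition tassoc (k : fieldType) (A B C : vectType k) :
    tensor A (tensor B C) -> tensor (tensor A B) C :=
  tlift (fun a => tlift (fun b c => (a ⊗ b) ⊗ c)).

(* The subspace V (x) W of A (x) B. *)
Definition tensorv (k : fieldType) (A B : vectType k)
    (V : {vspace A}) (W : {vspace B}) : {vspace tensor A B} :=
  <<[seq a ⊗ b | a <- vbasis V, b <- vbasis W]>>%VS.

Record hopf_structure (k : fieldType) (A : falgType k) := HopfStructure {
  comul : 'AHom(A, tensor A A);
  counit : 'AHom(A, k^o);
  antipode : 'End(A);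
  comulA : forall a : A,
    tmap comul idfun (comul a) = tassoc (tmap idfun comul (comul a));
  counitl : forall a : A, tlift (fun b c => (counit b : k) *: c) (comul a) = a;
  counitr : forall a : A, tlift (fun b c => (counit c : k) *: b) (comul a) = a;
  antipodel : forall a : A,
    tlift (fun b c => antipode b * c) (comul a) = (counit a : k)%:A;
  antipoder : forall a : A,
    tlift (fun b c => b * antipode c) (comul a) = (counit a : k)%:A }.

Arguments comul {k A} h : rename.
Arguments counit {k A} h : rename.
Arguments antipode {k A} h : rename.

(* Compatibility with the antipodes is automatic. *)
Definition is_hopf_map (k : fieldType) (A B : falgType k)
    (hA : hopf_structure A) (hB : hopf_structure B) (f : 'Hom(A, B)) : Prop :=
  [/\ f 1 = 1,
      forall a b, f (a * b) = f a * f b,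
      forall a, comul hB (f a) = tmap f f (comul hA a)
    & forall a, counit hB (f a) = counit hA a].

Section HopfNotions.
Variables (k : fieldType) (C : falgType k) (hC : hopf_structure C).

Definition is_hopf_subalgebra (R : {aspace C}) : Prop :=
  [/\ 1 \in R,
      forall r, r \in R -> comul hC r \in tensorv R R
    & forall r, r \in R -> antipode hC r \in R].

Definition adl (c r : C) : C :=
  tlift (fun c1 c2 => c1 * r * antipode hC c2) (comul hC c).
Definition adr (c r : C) : C :=
  tlift (fun c1 c2 => antipode hC c1 * r * c2) (comul hC c).

Definition is_normal (R : {vspace C}) : Prop :=
  forall c r, r \in R -> adl c r \in R /\ adr c r \in R.

Definition is_coinvariant (B : falgType k) (pi : 'Hom(C, B)) (c : C) : Prop :=
  tmap idfun pi (comul hC c) = c ⊗ 1.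

End HopfNotions.

Record exact_sequence (k : fieldType) (A C B : falgType k)
    (hA : hopf_structure A) (hC : hopf_structure C) (hB : hopf_structure B)
    (iota : 'Hom(A, C)) (pi : 'Hom(C, B)) : Prop := ExactSequence {
  exact_iota_hopf : is_hopf_map hA hC iota;
  exact_pi_hopf : is_hopf_map hC hB pi;
  exact_iota_inj : injective iota;
  exact_pi_surj : forall b : B, exists c : C, pi c = b;
  exact_ker : lker pi = ({:C} * (iota @: lker (counit hA)))%VS;
  exact_coinv : forall c : C, c \in limg iota <-> is_coinvariant hC pi c }.

(* Left ideals of a unital algebra are subspaces. *)
Definition is_left_ideal (k : fieldType) (A : falgType k) (I : {vspace A}) :=
  ({:A} * I <= I)%VS.

Definition is_maximal_left_ideal (k : fieldType) (A : falgType k)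
    (I : {vspace A}) : Prop :=
  [/\ is_left_ideal I, I != fullv
    & forall J : {vspace A}, is_left_ideal J -> (I <= J)%VS ->
        J = I \/ J = fullv].

Definition is_local (k : fieldType) (A : falgType k) : Prop :=
  exists! I : {vspace A}, is_maximal_left_ideal I.

Record double_relations (k : fieldType) (p : nat) (B : algType k)
    (u v zeta g x y : B) : Prop := DoubleRelations {
  rel_gp : g ^+ p = 1;
  rel_gx : g * x = x * g;
  rel_gy : g * y = y * g + x * g;
  rel_xp : x ^+ p = 0;
  rel_yp : y ^+ p = 0;
  rel_yx : y * x = x * y - 2%:R^-1 *: x ^+ 2;
  rel_zetap : zeta ^+ p = zeta;
  rel_gzeta : g * zeta = zeta * g;
  rel_vp : v ^+ p = 0;
  rel_up : u ^+ p = 0;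
  rel_vu : v * u = u * v - 2%:R^-1 *: u ^+ 2;
  rel_vzeta : v * zeta = zeta * v + v;
  rel_uzeta : u * zeta = zeta * u + u;
  rel_zetay : zeta * y = y * zeta + y;
  rel_zetax : zeta * x = x * zeta + x;
  rel_vg : v * g = g * v + g * u;
  rel_ug : u * g = g * u;
  rel_vx : v * x = x * v + (1 - g) + x * u;
  rel_ux : u * x = x * u;
  rel_uy : u * y = y * u + (1 - g);
  rel_vy : v * y = y * v - g * zeta + y * u }.

(* D(H) is taken in its presentation: [double_gen], [double_rel] and
   [double_univ] say that D is the quotient of the free algebra on the six
   generators by the ideal of the relations (surjectivity comes from
   [double_gen], and [double_univ] applied to the quotient gives injectivity).
   The counit and the antipode are determined by the coproduct. *)
Record is_drinfeld_double (k : fieldType) (p : nat) (D : falgType k)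
    (hD : hopf_structure D) (u v zeta g x y : D) : Prop := IsDrinfeldDouble {
  double_gen : agenv <<[:: u; v; zeta; g; x; y]>> = {:D}%VS;
  double_rel : double_relations p u v zeta g x y;
  double_univ : forall (B : algType k) (u' v' zeta' g' x' y' : B),
    double_relations p u' v' zeta' g' x' y' ->
    exists phi : {lrmorphism D -> B},
      [/\ phi u = u', phi v = v' & phi zeta = zeta'] /\
      [/\ phi g = g', phi x = x' & phi y = y'];
  double_comul_g : comul hD g = g ⊗ g;
  double_comul_x : comul hD x = x ⊗ 1 + g ⊗ x;
  double_comul_y : comul hD y = y ⊗ 1 + g ⊗ y;
  double_comul_zeta : comul hD zeta = zeta ⊗ 1 + 1 ⊗ zeta;
  double_comul_u : comul hD u = u ⊗ 1 + 1 ⊗ u;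
  double_comul_v : comul hD v = v ⊗ 1 + 1 ⊗ v + zeta ⊗ u }.

Definition sl2 (k : fieldType) : {vspace 'M[k]_2} :=
  lker (linfun (mxtrace : 'M[k]_2 -> k^o)).

Lemma mem_sl2 (k : fieldType) (a : 'M[k]_2) : (a \in sl2 k) = (\tr a == 0).
Proof. by rewrite memv_ker lfunE. Qed.

Definition sl2_bracket (k : fieldType) (a b : subvs_of (sl2 k)) :
    subvs_of (sl2 k) :=
  vsproj (sl2 k) (val a * val b - val b * val a).

(* The p-map of sl_2 in characteristic p is the p-th power of matrices. *)
Definition sl2_pmap (k : fieldType) (p : nat) (a : subvs_of (sl2 k)) :
    subvs_of (sl2 k) :=
  vsproj (sl2 k) (val a ^+ p).

Lemma val_sl2_bracket (k : fieldType) (a b : subvs_of (sl2 k)) :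
  val (sl2_bracket a b) = val a * val b - val b * val a.
Proof.
by apply: vsprojK; rewrite mem_sl2 linearB /= mxtrace_mulC subrr.
Qed.

Lemma val_sl2_pmap (k : fieldType) (p : nat) (a : subvs_of (sl2 k)) :
  odd p -> val (sl2_pmap p a) = val a ^+ p.
Proof.
move=> p_odd; apply: vsprojK; rewrite mem_sl2.
have tra : \tr (val a) = 0 by apply/eqP; rewrite -mem_sl2; apply: valP.
move: {a}(val a) tra => a; rewrite {1}/mxtrace big_ord_recl big_ord1 => /eqP.
rewrite addr_eq0 => /eqP a00.
have [c a2] : exists c : k, a ^+ 2 = c%:A.
  exists (a ord_max ord_max ^+ 2 + a 0 ord_max * a ord_max 0).
  have i01 (i : 'I_2) : i = 0 \/ i = ord_max.
    by case: i => [[|[|]]] // lti; [left | right]; apply: val_inj.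
  have l01 : lift ord0 ord0 = ord_max :> 'I_2 by apply: val_inj.
  move: a00; rewrite l01 => a00.
  apply/matrixP=> i j; rewrite expr2 !mxE big_ord_recl big_ord1 l01.
  by case: (i01 i) => ->; case: (i01 j) => -> /=;
    rewrite ?a00 ?mulr1 ?mulr0 ?mulrNN ?mulNr ?mulrN;
    rewrite ?[a ord_max 0 * _]mulrC ?[_ * a ord_max ord_max]mulrC;
    rewrite ?addNr ?subrr ?expr2 // addrC.
rewrite -(odd_double_half p) p_odd exprD -mul2n exprM a2 expr1 exprZn expr1n.
rewrite -scalerAr mulr1 mxtraceZ /mxtrace big_ord_recl big_ord1 a00.
by rewrite addNr mulr0.
Qed.

Definition is_restricted_hom (k : fieldType) (p : nat) (B : algType k)
    (j : {linear subvs_of (sl2 k) -> B}) : Prop :=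
  (forall a b, j (sl2_bracket a b) = j a * j b - j b * j a) /\
  (forall a, j (sl2_pmap p a) = j a ^+ p).

(* U(sl_2) modulo a ^ p - a^[p] for all a, through its universal property. *)
Record is_restricted_enveloping_sl2 (k : fieldType) (p : nat) (U : falgType k)
    (hU : hopf_structure U) (j : {linear subvs_of (sl2 k) -> U}) : Prop :=
  IsRestrictedEnvelopingSl2 {
  usl2_gen : agenv (limg (linfun j)) = {:U}%VS;
  usl2_rel : is_restricted_hom p j;
  usl2_univ : forall (B : algType k) (j' : {linear subvs_of (sl2 k) -> B}),
    is_restricted_hom p j' ->
    exists phi : {lrmorphism U -> B}, forall a, phi (j a) = j' a;
  usl2_comul : forall a, comul hU (j a) = j a ⊗ 1 + 1 ⊗ j a }.

Definition truncated_relations (k : fieldType) (p : nat) (B : algType k)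
    (g x u : B) : Prop :=
  [/\ g ^+ p = 1, x ^+ p = 0 & u ^+ p = 0].

Record truncated_presentation (k : fieldType) (p : nat) (A : falgType k)
    (g x u : A) : Prop := TruncatedPresentation {
  trunc_comm : forall a b : A, a * b = b * a;
  trunc_gen : agenv <<[:: g; x; u]>> = {:A}%VS;
  trunc_rel : truncated_relations p g x u;
  trunc_univ : forall (B : comAlgType k) (g' x' u' : B),
    truncated_relations p g' x' u' ->
    exists phi : {lrmorphism A -> B},
      [/\ phi g = g', phi x = x' & phi u = u'] }.

(* Main.v *)
Require Import Defs.
From HB Require Import structures.
From mathcomp Require Import all_boot all_order all_algebra all_field.

Set Implicit Arguments.
Unset Strict Implicit.
Unset Printing Implicit Defensive.

Import GRing.Theory VectorInternalTheory.
Local Open Scope ring_scope.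

(** The algebra R is commutative because g, x and u commute, and its elements
    satisfy r^p = ε(r)^p, which makes it local. It is a Hopf subalgebra by the
    coproducts of its generators. It is normal because g acts trivially on it, the
    other generators of D act through commutators, and the commutators of y, zeta
    and v with g, x and u lie in R.

    The dimension of R is a statement about D, which is only known through its
    presentation, so a representation is needed that separates enough of R. The
    standard representation of sl2 deforms to one over the dual numbers in which
    g - 1, x and u act by ε h, 2 ε e and ε f ([rep_relations]). The coefficients of
    ε are derivations at the counit of R. Contracting the coproduct with them gives
    invariant derivations of R that act on the monomials g^i x^j u^l as g d/dg,
    g d/dx and d/du, and these derivations force the monomials with exponents below
    p to be independent ([R_monomials_free]).

    The quotient map sends y, zeta, v to e, h/2, f/2, sends g to 1 and kills x and
    u. Exactness rests on two facts. First, D is spanned over R by the monomials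
    y^a zeta^b v^c with exponents below p ([double_span]). Second, the images of these
    monomials in u(sl2) are linearly independent ([usl2_pbw_free]): these are ordered
    monomials in primitive elements, and in characteristic p such monomials are
    independent as soon as there are functionals that vanish at 1 and are dual to
    these elements ([primitive_words_free]), which is the case because sl2 acts on k^2.
    Given these facts, an element Σ m_α r_α of the kernel has all ε(r_α) = 0 and so
    lies in D R^+ ([quotient_ker]), and a coinvariant element can have no r_α with
    α ≠ 0, by looking at the monomials of highest degree in the second factor of its
    coproduct ([coinvariant_R]). *)

(** * Bilinear maps and tensor products *)

Section Tensors.
Variables (k : fieldType) (A B : vectType k).
Implicit Types (a : A) (b : B) (s t : tensor A B) (V W : lmodType k).

Fact pure_is_linear a : linear (@pure k A B a).
Proof. exact: (proj1 (@pure_bilinear k A B)). Qed.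
HB.instance Definition _ a :=
  GRing.isLinear.Build k B (tensor A B) *:%R (pure a) (pure_is_linear a).

Fact purel_is_linear b : linear (@pure k A B ^~ b).
Proof. exact: (proj2 (@pure_bilinear k A B)). Qed.

Lemma pureDl a a' b : (a + a') ⊗ b = a ⊗ b + a' ⊗ b.
Proof. by have := purel_is_linear b 1 a a'; rewrite /= !scale1r. Qed.

Lemma pure0l b : (0 : A) ⊗ b = 0.
Proof. by have := purel_is_linear b (-1) 0 0; rewrite /= !scaleN1r !addNr. Qed.

Lemma pureZl c a b : (c *: a) ⊗ b = c *: (a ⊗ b).
Proof. by have := purel_is_linear b c a 0; rewrite /= pure0l !addr0. Qed.

Lemma pureNl a b : (- a) ⊗ b = - (a ⊗ b).
Proof. by rewrite -!scaleN1r pureZl. Qed.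

Lemma pure_suml (I : finType) (F : I -> A) b :
  (\sum_i F i) ⊗ b = \sum_i F i ⊗ b.
Proof. exact: (big_morph (fun a => a ⊗ b) (fun a a' => pureDl a a' b) (pure0l b)). Qed.

(** A scalar multiple of a pure tensor is pure, so every tensor is a sum of pure
    ones and additive statements may be checked on those. *)
Lemma tensor_ind (P : tensor A B -> Prop) :
  (forall a b, P (a ⊗ b)) -> (forall s t, P s -> P t -> P (s + t)) ->
  forall t, P t.
Proof.
move=> Pp Pa t; rewrite [t]tensor_sum.
have P0 : P 0 by rewrite -(pure0l 0).
by do 2![elim/big_ind: _ => // ? _]; rewrite -pureZl.
Qed.

Lemma tlift_comp V W (L : {linear V -> W}) (f : A -> B -> V) t :
  L (tlift f t) = tlift (fun a b => L (f a b)) t.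
Proof.
rewrite /tlift linear_sum; apply: eq_bigr => i _; rewrite linear_sum.
by apply: eq_bigr => j _; rewrite linearZ.
Qed.

Lemma eq_tlift V (f f' : A -> B -> V) t :
  (forall a b, f a b = f' a b) -> tlift f t = tlift f' t.
Proof.
by move=> ff'; apply: eq_bigr => i _; apply: eq_bigr => j _; rewrite ff'.
Qed.

Lemma tliftB V (f f' : A -> B -> V) t :
  tlift (fun a b => f a b - f' a b) t = tlift f t - tlift f' t.
Proof.
rewrite /tlift -sumrB; apply: eq_bigr => i _; rewrite -sumrB.
by apply: eq_bigr => j _; rewrite scalerBr.
Qed.

Lemma tlift_pure t : tlift (@pure k A B) t = t.
Proof. exact: esym (tensor_sum t). Qed.

Lemma tlift_linear V W (f : V -> A -> B -> W) t :
  (forall a b, linear (fun v => f v a b)) -> linear (fun v => tlift (f v) t).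
Proof.
move=> fl c v v'; rewrite /tlift scaler_sumr -big_split; apply: eq_bigr => i _.
rewrite scaler_sumr -big_split; apply: eq_bigr => j _ /=.
by rewrite fl scalerDr !scalerA mulrC.
Qed.

Lemma bilinear_mul (E : algType k) (f : {linear A -> E}) (g : {linear B -> E}) :
  bilinear_map (fun a b => f a * g b).
Proof.
split=> [a c b b' | b c a a']; rewrite /= linearP.
  by rewrite mulrDr scalerAr.
by rewrite mulrDl scalerAl.
Qed.

Lemma bilinear_scaler V (f : {linear B -> k^o}) (g : {linear A -> V}) :
  bilinear_map (fun a b => (f b : k) *: g a).
Proof.
split=> [a c b b' | b c a a']; rewrite /= linearP.
  by rewrite scalerDl scalerA.
by rewrite scalerDr !scalerA mulrC.
Qed.

Lemma bilinear_scalel V (f : {linear A -> k^o}) (g : {linear B -> V}) :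
  bilinear_map (fun a b => (f a : k) *: g b).
Proof.
split=> [a c b b' | b c a a']; rewrite /= linearP.
  by rewrite scalerDr !scalerA mulrC.
by rewrite scalerDl scalerA.
Qed.

(** In coordinates on A, every row of such a tensor is a linear relation between
    the m i. *)
Lemma tensor_indep (I : finType) (m : I -> B) :
  (forall c : I -> k, \sum_i c i *: m i = 0 -> forall i, c i = 0) ->
  forall w : I -> A, \sum_i w i ⊗ m i = 0 -> forall i, w i = 0.
Proof.
move=> m_free w w0 i; apply: (can_inj v2rK). rewrite linear0.
apply/rowP=> a; rewrite mxE; move: i; apply: m_free.
apply: (can_inj v2rK); rewrite linear0 linear_sum; apply/rowP=> b.
have := congr1 (fun t : 'M_(_, _) => t a b) w0; rewrite /= [RHS]mxE => w0ab.
rewrite [RHS]mxE -w0ab !summxE.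
by apply: eq_bigr => i _; rewrite linearZ mxE pureE.
Qed.
End Tensors.

Lemma tlift_exchange (k : fieldType) (A B C E : vectType k) (V : lmodType k)
    (f : A -> B -> C -> E -> V) (s : tensor A B) (t : tensor C E) :
  tlift (fun a b => tlift (fun c d => f a b c d) t) s =
  tlift (fun c d => tlift (fun a b => f a b c d) s) t.
Proof.
rewrite /tlift !pair_bigA /=.
under eq_bigr do rewrite pair_bigA scaler_sumr.
under [RHS]eq_bigr do rewrite pair_bigA scaler_sumr.
rewrite exchange_big; apply: eq_bigr => cd _; apply: eq_bigr => ab _ /=.
by rewrite !scalerA mulrC.
Qed.

Lemma tliftM (k : fieldType) (A B : falgType k) (V : lmodType k)
    (f : A -> B -> V) (s t : tensor A B) : bilinear_map f ->
  tlift f (s * t) = tlift (fun a b => tlift (fun c d => f (a * c) (b * d)) t) s.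
Proof.
move=> fl; rewrite -[s * t]/(tmul s t) /tmul (tlift_comp (tlift f)).
apply: eq_tlift => a b; rewrite (tlift_comp (tlift f)).
by apply: eq_tlift => c d; exact: (tliftE fl).
Qed.

Section TensorMap.
Variables (k : fieldType) (A B C E : vectType k).

HB.instance Definition _ (f : A -> C) (g : B -> E) :=
  GRing.Linear.copy (tmap f g) (tlift (fun a b => f a ⊗ g b)).

Lemma bilinear_tmap (f : {linear A -> C}) (g : {linear B -> E}) :
  bilinear_map (fun a b => f a ⊗ g b).
Proof.
split=> [a c b b' | b c a a']; first by rewrite /= !linearP.
by rewrite /= linearP pureDl pureZl.
Qed.

Lemma tmapE (f : {linear A -> C}) (g : {linear B -> E}) a b :
  tmap f g (a ⊗ b) = f a ⊗ g b.
Proof. by rewrite /tmap tliftE //; exact: bilinear_tmap. Qed.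
End TensorMap.

Lemma tmap_comp (k : fieldType) (A1 A2 A3 B1 B2 B3 : vectType k)
    (f : {linear A1 -> A2}) (f' : {linear A2 -> A3})
    (g : {linear B1 -> B2}) (g' : {linear B2 -> B3}) t :
  tmap f' g' (tmap f g t) = tmap (f' \o f) (g' \o g) t.
Proof.
elim/tensor_ind: t => [a b | s t IHs IHt]; first by rewrite !tmapE.
by rewrite !linearD /= IHs IHt.
Qed.

Lemma eq_tmap (k : fieldType) (A B C E : vectType k) (f f' : A -> C)
    (g g' : B -> E) t : f =1 f' -> g =1 g' -> tmap f g t = tmap f' g' t.
Proof. by move=> ff' gg'; apply: eq_tlift => a b; rewrite ff' gg'. Qed.

Lemma tlift_tmap (k : fieldType) (A B C E : vectType k) (V : lmodType k)
    (f : A -> C) (g : B -> E) (F : C -> E -> V) t : bilinear_map F ->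
  tlift F (tmap f g t) = tlift (fun a b => F (f a) (g b)) t.
Proof.
move=> Fl; rewrite /tmap (tlift_comp (tlift F)).
by apply: eq_tlift => a b; exact: (tliftE Fl).
Qed.

Lemma tmap_id (k : fieldType) (A B : vectType k) (f : A -> A) (g : B -> B) t :
  f =1 id -> g =1 id -> tmap f g t = t.
Proof.
by move=> f1 g1; rewrite -[RHS]tlift_pure; apply: eq_tlift => a b; rewrite f1 g1.
Qed.

Section TensorRingMap.
Variables (k : fieldType) (A B C E : falgType k).
Variables (f : {lrmorphism A -> C}) (g : {lrmorphism B -> E}).

Fact tmap_is_monoid_morphism : monoid_morphism (tmap f g).
Proof.
split=> [|s t]; first by rewrite tensor1E tmapE !rmorph1.
elim/tensor_ind: s => [a b | s s' IHs IHs']; last by rewrite mulrDl !linearD /= mulrDl IHs IHs'.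
elim/tensor_ind: t => [c d | s s' IHs IHs']; last by rewrite mulrDr !linearD /= mulrDr IHs IHs'.
by rewrite pureM !tmapE pureM !rmorphM.
Qed.
HB.instance Definition _ :=
  GRing.isMonoidMorphism.Build (tensor A B) (tensor C E) (tmap f g)
    tmap_is_monoid_morphism.
End TensorRingMap.

Section TensorAssoc.
Variables (k : fieldType) (A B C : vectType k).

HB.instance Definition _ := GRing.Linear.copy (@tassoc k A B C)
  (tlift (fun a => tlift (fun b c => (a ⊗ b) ⊗ c))).

Lemma tassocE (a : A) (t : tensor B C) :
  tassoc (a ⊗ t) = tlift (fun b c => (a ⊗ b) ⊗ c) t.
Proof.
rewrite /tassoc tliftE //; split=> [{}a | {}t]; first exact: tlift_is_linear.
apply: (@tlift_linear _ _ _ A _ (fun a b c => (a ⊗ b) ⊗ c)) => b c z a1 a2.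
by rewrite !pureDl !pureZl.
Qed.
End TensorAssoc.

Lemma tassoc_tmap (k : fieldType) (A B C A' B' C' : vectType k)
    (f : {linear A -> A'}) (g : {linear B -> B'}) (h : {linear C -> C'}) t :
  tassoc (tmap f (tmap g h) t) = tmap (tmap f g) h (tassoc t).
Proof.
elim/tensor_ind: t => [a t | s t IHs IHt]; last by rewrite !linearD /= IHs IHt.
rewrite tmapE !tassocE tlift_tmap; last exact: (bilinear_tmap (pure (f a)) idfun).
rewrite (tlift_comp (tmap (tmap f g) h)); apply: eq_tlift => b c.
by rewrite /= tmapE /= tmapE.
Qed.

Lemma tmap_vsprojK (k : fieldType) (A B : vectType k)
    (V : {vspace A}) (W : {vspace B}) (t : tensor A B) : t \in tensorv V W ->
  tmap (vsval : subvs_of V -> A) (vsval : subvs_of W -> B)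
    (tmap (vsproj V) (vsproj W) t) = t.
Proof.
set F := tmap vsval vsval \o tmap (vsproj V) (vsproj W) => tVW.
have /subvP/(_ _ tVW) : (tensorv V W <= lker (linfun F - \1%VF))%VS.
  apply/span_subvP => _ /allpairsP[[a b] /= [/vbasis_mem aV /vbasis_mem bW ->]].
  rewrite memv_ker add_lfunE opp_lfunE id_lfunE lfunE /= !tmapE /=.
  by rewrite !vsprojK // subrr.
by rewrite memv_ker add_lfunE opp_lfunE id_lfunE lfunE subr_eq0 => /eqP.
Qed.

Lemma mem_tensorv (k : fieldType) (A B : vectType k)
    (V : {vspace A}) (W : {vspace B}) a b :
  a \in V -> b \in W -> a ⊗ b \in tensorv V W.
Proof.
move=> /coord_vbasis-> /coord_vbasis->.
rewrite pure_suml memv_suml // => i _; rewrite linear_sum memv_suml // => j _.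
rewrite linearZ /= pureZl !memvZ // memv_span //; apply/allpairsP.
by exists ((vbasis V)`_i, (vbasis W)`_j); rewrite !mem_nth ?size_tuple.
Qed.

(** * Antipodes and adjoint actions *)

Section HopfTheory.
Variables (k : fieldType) (D : falgType k) (h : hopf_structure D).
Local Notation Δ := (comul h).
Local Notation ε := (counit h).
Local Notation S := (antipode h).

Let conv (F : {linear D -> D}) : {linear tensor D D -> D} :=
  tlift (fun b c => F b * c).

(** A linear map is recovered from its convolution with the identity by
    convolving further with the antipode: F(a) = Σ F(a1) a2 S(a3). *)
Lemma convolution_injective (F : {linear D -> D}) :
  (forall a, tlift (fun b c => F b * c) (Δ a) = 0) -> forall a, F a = 0.
Proof.
move=> F0 a.
pose L : {linear tensor (tensor D D) D -> D} :=
  tlift (fun (t : tensor D D) d => conv F t * S d).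
have LE t d : L (t ⊗ d) = conv F t * S d.
  exact: (tliftE (bilinear_mul (conv F) S)).
have L1 t : L (tmap Δ idfun t) = 0.
  elim/tensor_ind: t => [b d | s t IHs IHt]; last by rewrite !linearD /= IHs IHt addr0.
  by rewrite tmapE LE /= F0 mul0r.
have L2 t : L (tassoc (tmap idfun Δ t)) =
    F (tlift (fun b c => (ε c : k) *: b) t).
  elim/tensor_ind: t => [b c | s t IHs IHt]; last by rewrite !linearD /= IHs IHt.
  rewrite tmapE tassocE [RHS](_ : _ = ((ε c : k) *: F b)); last first.
    by rewrite tliftE ?linearZ //; exact: (bilinear_scaler ε idfun).
  rewrite [LHS](tlift_comp L) /= -[F b]mulr1 scalerAr -(antipoder h).
  rewrite -[RHS]/((F b \*o idfun) _) tlift_comp; apply: eq_tlift => b' c' /=.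
  by rewrite LE /= tliftE ?mulrA //; exact: (bilinear_mul F idfun).
by rewrite -(counitr h a) -L2 -comulA L1.
Qed.

Lemma antipode1 : S 1 = 1.
Proof.
have := antipodel h 1; rewrite !rmorph1 scale1r tensor1E tliftE ?mulr1 //.
exact: (bilinear_mul S idfun).
Qed.

(** Both a ⊗ b |-> S (a b) and a ⊗ b |-> S b S a are convolution inverses of the
    multiplication D ⊗ D -> D. *)
Lemma antipodeM a b : S (a * b) = S b * S a.
Proof.
(* Injectivity of convolution is applied to the defect F in each argument in
   turn; the doubly convolved defect is ε(a) ε(b) - ε(a) ε(b). *)
pose F (a b : D) : D := S (a * b) - S b * S a.
have Flin a' : linear (F a').
  move=> c b1 b2; rewrite /F mulrDr -scalerAr !linearP mulrDl -scalerAl.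
  by rewrite opprD addrACA scalerBr.
have Flinl b' : linear (F^~ b').
  move=> c b1 b2; rewrite /F mulrDl -scalerAl !linearP mulrDr -scalerAr.
  by rewrite opprD addrACA scalerBr.
pose Fl b' : {linear D -> D} :=
  HB.pack (F^~ b') (GRing.isLinear.Build k D D *:%R _ (Flinl b')).
suff : Fl b a = 0 by move/eqP; rewrite subr_eq0 => /eqP.
apply: convolution_injective => {}a /=.
pose G b' := tlift (fun a1 a2 => F a1 b' * a2) (Δ a).
have Glin : linear G.
  apply: (@tlift_linear _ _ _ D D (fun b' a1 a2 => F a1 b' * a2)) => a1 a2 c b1 b2.
  by rewrite Flin mulrDl scalerAl.
pose Gl : {linear D -> D} := HB.pack G (GRing.isLinear.Build k D D *:%R _ Glin).
rewrite -/(G b) -[G b]/(Gl b); apply: convolution_injective => {}b /=.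
transitivity (tlift (fun b1 b2 =>
    tlift (fun a1 a2 => S (a1 * b1) * (a2 * b2)) (Δ a)
    - (ε a : k) *: (S b1 * b2)) (Δ b)).
  apply: eq_tlift => b1 b2; rewrite -[LHS]/((b2 \o* idfun) _) tlift_comp /=.
  transitivity (tlift (fun a1 a2 => S (a1 * b1) * (a2 * b2)
      - ((b2 \o* idfun) \o (S b1 \*o idfun)) (S a1 * a2)) (Δ a)).
    by apply: eq_tlift => a1 a2; rewrite /= mulrBl mulrBl !mulrA.
  by rewrite tliftB -tlift_comp antipodel /= -scalerAr mulr1 scalerAl.
rewrite tliftB; have -> : tlift (fun b1 b2 => (ε a : k) *: (S b1 * b2)) (Δ b)
    = (ε a : k) *: tlift (fun b1 b2 => S b1 * b2) (Δ b).
  exact: esym (tlift_comp ((ε a : k) \*: idfun) _ _).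
rewrite -tlift_exchange -(tliftM _ _ (bilinear_mul S idfun)) -rmorphM.
by rewrite !antipodel /= scalerA rmorphM subrr.
Qed.

Lemma counit_grouplike g : g != 0 -> Δ g = g ⊗ g -> ε g = 1.
Proof.
move=> g0 Δg; have := counitr h g; rewrite Δg tliftE; last exact: (bilinear_scaler ε idfun).
move/eqP; rewrite -subr_eq0 -{3}[g]scale1r -scalerBl scaler_eq0 (negPf g0) orbF.
by rewrite subr_eq0 => /eqP.
Qed.

Lemma counit_skew_primitive g a : g != 0 -> Δ a = a ⊗ 1 + g ⊗ a -> ε a = 0.
Proof.
move=> g0 Δa; have := counitr h a; rewrite Δa linearD /=.
rewrite !tliftE; try exact: (bilinear_scaler ε idfun).
rewrite rmorph1 scale1r => /(canRL (addKr _))/eqP; rewrite addNr scaler_eq0.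
by rewrite (negPf g0) orbF => /eqP.
Qed.

Lemma antipode_grouplike g : g != 0 -> Δ g = g ⊗ g -> S g * g = 1 /\ g * S g = 1.
Proof.
move=> g0 Δg; have := antipodel h g; have := antipoder h g.
rewrite (counit_grouplike g0 Δg) Δg !scale1r !tliftE //; first exact: (bilinear_mul S idfun).
exact: (bilinear_mul idfun S).
Qed.

Lemma antipode_skew_primitive g a : g != 0 -> Δ a = a ⊗ 1 + g ⊗ a ->
  S a = - (S g * a).
Proof.
move=> g0 Δa; have := antipodel h a.
rewrite (counit_skew_primitive g0 Δa) Δa linearD /= !tliftE; try exact: (bilinear_mul S idfun).
by rewrite scale0r mulr1 => /eqP; rewrite addr_eq0 => /eqP.
Qed.

Lemma adlM c c' r : adl h (c * c') r = adl h c (adl h c' r).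
Proof.
rewrite /adl rmorphM tliftM; last exact: (bilinear_mul (r \o* idfun) S).
apply: eq_tlift => a b; rewrite -[RHS]/((S b \o* (a \*o idfun)) _) tlift_comp.
by apply: eq_tlift => a' b'; rewrite /= antipodeM !mulrA.
Qed.

Lemma adrM c c' r : adr h (c * c') r = adr h c' (adr h c r).
Proof.
rewrite /adr rmorphM tliftM; last exact: (bilinear_mul (r \o* S) idfun).
rewrite tlift_exchange.
apply: eq_tlift => a b; rewrite -[RHS]/((b \o* (S a \*o idfun)) _) tlift_comp.
by apply: eq_tlift => a' b'; rewrite /= antipodeM !mulrA.
Qed.

(** Because S a = - S g a, the second term of the adjoint action is
    - g r g^-1 a, which is - r a as soon as g and r commute. *)
Lemma adl_skew_primitive g a r : g != 0 -> Δ g = g ⊗ g -> Δ a = a ⊗ 1 + g ⊗ a ->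
  g * r = r * g -> adl h a r = a * r - r * a.
Proof.
move=> g0 Δg Δa gr; rewrite /adl Δa linearD /= !tliftE;
  try exact: (bilinear_mul (r \o* idfun) S).
have [_ gSg] := antipode_grouplike g0 Δg.
rewrite /= antipode1 mulr1 (antipode_skew_primitive g0 Δa) mulrN gr.
by rewrite -!mulrA (mulrA g) gSg mul1r.
Qed.

Lemma adr_skew_primitive g a r : g != 0 -> Δ a = a ⊗ 1 + g ⊗ a ->
  adr h a r = S g * (r * a - a * r).
Proof.
move=> g0 Δa; rewrite /adr Δa linearD /= !tliftE;
  try exact: (bilinear_mul (r \o* S) idfun).
rewrite /= mulr1 (antipode_skew_primitive g0 Δa) mulNr -!mulrA addrC.
by rewrite mulrBr.
Qed.

Lemma adl_grouplike g r : Δ g = g ⊗ g -> adl h g r = g * r * S g.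
Proof. by move=> Δg; rewrite /adl Δg (tliftE (bilinear_mul (r \o* idfun) S)). Qed.

Lemma adr_grouplike g r : Δ g = g ⊗ g -> adr h g r = S g * r * g.
Proof. by move=> Δg; rewrite /adr Δg (tliftE (bilinear_mul (r \o* S) idfun)). Qed.

End HopfTheory.

(** * Hopf subalgebras *)

Section HopfSubalgebra.
Variables (k : fieldType) (D : falgType k) (h : hopf_structure D).
Variables (R : {aspace D}) (R_hopf : is_hopf_subalgebra h R).
Local Notation Δ := (comul h).
Local Notation ε := (counit h).
Local Notation S := (antipode h).

Fact vsval_is_monoid_morphism : monoid_morphism (vsval : subvs_of R -> D).
Proof. by have [R1 _ _] := R_hopf; split=> //=; apply/eqP; rewrite algid_eq1. Qed.

Definition subalg_incl : {lrmorphism subvs_of R -> D} :=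
  HB.pack (vsval : subvs_of R -> D)
    (GRing.isLinear.Build k (subvs_of R) D *:%R vsval (@vsval_is_linear k D R))
    (GRing.isMonoidMorphism.Build _ _ _ vsval_is_monoid_morphism).
Local Notation ι := subalg_incl.

Lemma subalg_inclK : cancel ι (vsproj R).
Proof. exact: vsvalK. Qed.

Lemma subalg_incl_tmapK : cancel (tmap ι ι) (tmap (vsproj R) (vsproj R)).
Proof. by move=> t; rewrite tmap_comp tmap_id //; exact: subalg_inclK. Qed.

(** The structure maps of D are corestricted to R through [vsproj]; each Hopf
    axiom can then be checked after the inclusion, where it is an axiom of D. *)
Definition sub_comul_fun (r : subvs_of R) : tensor (subvs_of R) (subvs_of R) :=
  tmap (vsproj R) (vsproj R) (Δ (ι r)).

Lemma sub_comulE r : tmap ι ι (sub_comul_fun r) = Δ (ι r).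
Proof. by have [_ RΔ _] := R_hopf; exact: tmap_vsprojK (RΔ _ (subvsP r)). Qed.

Fact sub_comul_is_linear : linear sub_comul_fun.
Proof. by move=> c a b; rewrite /sub_comul_fun !linearP. Qed.

Fact sub_comul_is_monoid_morphism : monoid_morphism sub_comul_fun.
Proof.
split=> [|a b]; apply: (can_inj subalg_incl_tmapK).
  by rewrite sub_comulE !rmorph1.
by rewrite sub_comulE !rmorphM /= -!sub_comulE.
Qed.

Definition sub_comul : {lrmorphism subvs_of R -> tensor (subvs_of R) (subvs_of R)} :=
  HB.pack sub_comul_fun (GRing.isLinear.Build k _ _ *:%R _ sub_comul_is_linear)
    (GRing.isMonoidMorphism.Build _ _ _ sub_comul_is_monoid_morphism).

Definition sub_counit : {lrmorphism subvs_of R -> k^o} := ε \o ι.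

Definition sub_antipode : {linear subvs_of R -> subvs_of R} := vsproj R \o S \o ι.

Lemma sub_antipodeE r : ι (sub_antipode r) = S (ι r).
Proof. by have [_ _ RS] := R_hopf; rewrite /= vsprojK // RS ?subvsP. Qed.

Lemma sub_comul_linfunE a : tmap ι ι (linfun sub_comul a) = Δ (ι a).
Proof. by rewrite lfunE; exact: sub_comulE. Qed.

Lemma tlift_sub_comul (V : lmodType k) (F : D -> D -> V) r : bilinear_map F ->
  tlift F (Δ (ι r)) = tlift (fun a b => F (ι a) (ι b)) (linfun sub_comul r).
Proof. by move=> Fl; rewrite -sub_comul_linfunE tlift_tmap. Qed.

Lemma sub_counit_scale r :
  ι ((linfun_ahom sub_counit r : k)%:A) = (ε (ι r) : k)%:A.
Proof. by rewrite -(rmorph1 ι) -linearZ lfunE. Qed.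

Fact sub_comulA r : tmap (linfun_ahom sub_comul) idfun (linfun_ahom sub_comul r) =
  tassoc (tmap idfun (linfun_ahom sub_comul) (linfun_ahom sub_comul r)).
Proof.
apply: (can_inj (g := tmap (tmap (vsproj R) (vsproj R)) (vsproj R))
          (f := tmap (tmap ι ι) ι)).
  by move=> t; rewrite tmap_comp tmap_id //; [exact: subalg_incl_tmapK | exact: subalg_inclK].
rewrite -tassoc_tmap !tmap_comp !lfunE /=.
transitivity (tmap Δ idfun (Δ (ι r))).
  rewrite -sub_comulE [RHS]tmap_comp; apply: eq_tmap => //.
  exact: sub_comul_linfunE.
rewrite comulA -sub_comulE [X in tassoc X]tmap_comp; congr tassoc.
apply: eq_tmap => // a; exact: esym (sub_comul_linfunE a).
Qed.

Fact sub_counitl r :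
  tlift (fun b c => (linfun_ahom sub_counit b : k) *: c) (linfun_ahom sub_comul r) = r.
Proof.
apply: subvs_inj; rewrite -[LHS]/(ι _) tlift_comp -[RHS](counitl h) tlift_sub_comul.
  by apply: eq_tlift => a b; rewrite lfunE linearZ.
exact: (bilinear_scalel ε idfun).
Qed.

Fact sub_counitr r :
  tlift (fun b c => (linfun_ahom sub_counit c : k) *: b) (linfun_ahom sub_comul r) = r.
Proof.
apply: subvs_inj; rewrite -[LHS]/(ι _) tlift_comp -[RHS](counitr h) tlift_sub_comul.
  by apply: eq_tlift => a b; rewrite lfunE linearZ.
exact: (bilinear_scaler ε idfun).
Qed.

Fact sub_antipodel r :
  tlift (fun b c => linfun sub_antipode b * c) (linfun_ahom sub_comul r) =
  (linfun_ahom sub_counit r : k)%:A.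
Proof.
apply: subvs_inj; rewrite -[LHS]/(ι _) -[RHS]/(ι _) tlift_comp sub_counit_scale.
rewrite -(antipodel h) tlift_sub_comul; last exact: (bilinear_mul S idfun).
by apply: eq_tlift => a b; rewrite -sub_antipodeE lfunE rmorphM.
Qed.

Fact sub_antipoder r :
  tlift (fun b c => b * linfun sub_antipode c) (linfun_ahom sub_comul r) =
  (linfun_ahom sub_counit r : k)%:A.
Proof.
apply: subvs_inj; rewrite -[LHS]/(ι _) -[RHS]/(ι _) tlift_comp sub_counit_scale.
rewrite -(antipoder h) tlift_sub_comul; last exact: (bilinear_mul idfun S).
by apply: eq_tlift => a b; rewrite -sub_antipodeE lfunE rmorphM.
Qed.

Definition sub_hopf : hopf_structure (subvs_of R) :=
  HopfStructure sub_comulA sub_counitl sub_counitr sub_antipodel sub_antipoder.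

Lemma sub_hopf_incl : is_hopf_map sub_hopf h (linfun (vsval : subvs_of R -> D)).
Proof.
split=> [|a b|a|a]; rewrite ?lfunE /=.
- exact: (rmorph1 ι).
- by [].
- rewrite -[vsval a]/(ι a) -sub_comulE.
  by apply: eq_tmap => b; rewrite lfunE.
- by [].
Qed.

End HopfSubalgebra.

(** * Straightening one variable at a time *)

Section GeneratedSubalgebras.
Variables (k : fieldType) (A : falgType k).

Definition linear_pred (P : A -> Prop) : Prop :=
  [/\ P 0, forall a b, P a -> P b -> P (a + b) & forall c a, P a -> P (c *: a)].

Lemma linear_pred_sum (P : A -> Prop) (I : finType) (F : I -> A) :
  linear_pred P -> (forall i, P (F i)) -> P (\sum_i F i).
Proof. by case=> P0 PD _ PF; elim/big_ind: _. Qed.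

Lemma span_linear_pred (P : A -> Prop) (X : seq A) : linear_pred P ->
  (forall a, a \in X -> P a) -> forall a, a \in <<X>>%VS -> P a.
Proof.
move=> Plin PX a aX; rewrite (coord_span (X := in_tuple X) aX).
by apply: linear_pred_sum => // i; have [_ _ PZ] := Plin; exact: PZ (PX _ (mem_nth _ (ltn_ord i))).
Qed.

Lemma agenv_ind (X : seq A) (P : A -> Prop) : linear_pred P -> P 1 ->
  (forall s a, s \in X -> P a -> P (s * a)) ->
  forall a, a \in agenv <<X>> -> P a.
Proof.
move=> Plin P1 PM a /memv_sumP[F FX ->].
apply: linear_pred_sum => // -[i /= lti]; have := FX (Ordinal lti) isT => /=.
move: (F _) => {lti}b; elim: i b => [|i IHi] b.
  by rewrite expv0 => /vlineP[c ->]; case: Plin => _ _; apply.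
rewrite expvSl unlock; apply: span_linear_pred => //.
move=> _ /allpairsP[[c d] /= [/vbasis_mem cX /vbasis_mem/IHi Pd ->]].
move: c cX; apply: span_linear_pred => [|s sX]; last exact: PM.
have [P0 PD PZ] := Plin; split=> [|c c'|z c]; rewrite ?mul0r ?mulrDl -?scalerAl; auto.
Qed.

Definition subalgebra_pred (P : A -> Prop) : Prop :=
  [/\ linear_pred P, P 1 & forall a b, P a -> P b -> P (a * b)].

Variables (t : A) (p : nat).

Definition power_span (P : A -> Prop) (a : A) : Prop :=
  exists2 F : 'I_p -> A, forall i, P (F i) & a = \sum_(i < p) t ^+ i * F i.

(** The condition a t ∈ t P + P: powers of t can be collected on the left at the
    cost of terms of lower degree in t. *)
Definition commutes_mod (P : A -> Prop) (a : A) : Prop :=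
  exists b c, [/\ P b, P c & a * t = t * b + c].

Section CommutesMod.
Variables (P : A -> Prop) (P_subalg : subalgebra_pred P).

Lemma commutes_mod_linear : linear_pred (commutes_mod P).
Proof.
have [[P0 PD PZ] P1 PM] := P_subalg; split.
- by exists 0, 0; rewrite mul0r mulr0 addr0.
- move=> a a' [b [c [Pb Pc e]]] [b' [c' [Pb' Pc' e']]].
  exists (b + b'), (c + c'); split; try exact: PD.
  by rewrite mulrDl e e' mulrDr addrACA.
- move=> z a [b [c [Pb Pc e]]]; exists (z *: b), (z *: c); split; try exact: PZ.
  by rewrite -scalerAl e scalerDr scalerAr.
Qed.

(** By this lemma and linearity, the condition for a subalgebra follows from
    the condition for its generators. *)
Lemma commutes_mod_mul a a' : P a ->
  commutes_mod P a -> commutes_mod P a' -> commutes_mod P (a * a').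
Proof.
have [[P0 PD PZ] P1 PM] := P_subalg.
move=> Pa [b [c [Pb Pc e]]] [b' [c' [Pb' Pc' e']]].
exists (b * b'), (c * b' + a * c'); split; auto.
by rewrite -mulrA e' mulrDr !mulrA e mulrDl addrA.
Qed.

Lemma commutes_mod1 : commutes_mod P 1.
Proof.
have [[P0 PD PZ] P1 PM] := P_subalg.
by exists 1, 0; rewrite mul1r mulr1 addr0.
Qed.

End CommutesMod.

Section PowerSpan.
Variables (P : A -> Prop) (P_subalg : subalgebra_pred P).
Hypothesis p_gt0 : (0 < p)%N.
Hypothesis t_pow : power_span P (t ^+ p).
Hypothesis t_comm : forall a, P a -> commutes_mod P a.
Local Notation Q := (power_span P).

Lemma power_span_linear : linear_pred Q.
Proof.
have [[P0 PD PZ] P1 PM] := P_subalg; split.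
- by exists (fun=> 0) => //; rewrite big1 // => i _; rewrite mulr0.
- move=> _ _ [F PF ->] [G PG ->]; exists (fun i => F i + G i) => [i|]; first exact: PD.
  by rewrite -big_split; apply: eq_bigr => i _; rewrite mulrDr.
- move=> z _ [F PF ->]; exists (fun i => z *: F i) => [i|]; first exact: PZ.
  by rewrite scaler_sumr; apply: eq_bigr => i _; rewrite scalerAr.
Qed.

Lemma power_span_mulr q a : Q q -> P a -> Q (q * a).
Proof.
have [_ _ PM] := P_subalg; move=> [F PF ->] Pa; exists (fun i => F i * a); first by auto.
by rewrite mulr_suml; apply: eq_bigr => i _; rewrite mulrA.
Qed.

Lemma power_span_term n a : (n < p)%N -> P a -> Q (t ^+ n * a).
Proof.
have [[P0 _ _] _ _] := P_subalg; move=> ltnp Pa.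
exists (fun i : 'I_p => if (i : nat) == n then a else 0) => [i|]; first by case: ifP.
rewrite (bigD1 (Ordinal ltnp)) //= eqxx big1 ?addr0 // => i.
by rewrite -val_eqE /= => /negPf->; rewrite mulr0.
Qed.

Lemma power_span_mul_gen q : Q q -> Q (t * q).
Proof.
case=> F PF ->; rewrite mulr_sumr; apply: linear_pred_sum; first exact: power_span_linear.
move=> i; rewrite mulrA -exprS.
have := ltn_ord i; rewrite leq_eqVlt => /orP[/eqP-> | lti].
  exact: power_span_mulr.
exact: power_span_term.
Qed.

Lemma power_span_incl a : P a -> Q a.
Proof. by move=> Pa; rewrite -[a]mul1r -(expr0 t); apply: power_span_term. Qed.

Lemma power_span_pow n a : P a -> Q (t ^+ n * a).
Proof.
move=> Pa; elim: n => [|n IHn]; first by rewrite mul1r; exact: power_span_incl.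
by rewrite exprS -mulrA; exact: power_span_mul_gen.
Qed.

(** Every t crossed by an element of P leaves an element of P behind it, either
    next to the same t or in place of it, so the induction is on the power of t. *)
Lemma power_span_mull a q : P a -> Q q -> Q (a * q).
Proof.
move=> Pa [F PF ->]; rewrite mulr_sumr; apply: linear_pred_sum; first exact: power_span_linear.
move=> i; move: (nat_of_ord i) (F i) (PF i) => {i} n b Pb.
have [_ _ PM] := P_subalg; have [_ QD _] := power_span_linear.
elim: n a Pa => [|n IHn] a Pa; first by rewrite mul1r; apply: power_span_incl; exact: PM.
have [a1 [a2 [Pa1 Pa2 e]]] := t_comm Pa.
rewrite exprS !mulrA e mulrDl mulrDl -!mulrA; apply: QD; last exact: IHn.
by apply: power_span_mul_gen; exact: IHn.
Qed.

(** One-variable straightening, as in the Poincaré-Birkhoff-Witt theorem: stability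
    under left multiplication by P and by t gives stability under products. *)
Lemma power_span_subalgebra : subalgebra_pred Q.
Proof.
have [_ P1 _] := P_subalg.
split; [exact: power_span_linear | exact: power_span_incl |].
move=> _ q [F PF ->] Qq; rewrite mulr_suml; apply: linear_pred_sum; first exact: power_span_linear.
move=> i; rewrite -mulrA; move: (power_span_mull (PF i) Qq).
elim: (nat_of_ord i) => [|n IHn] QFq; first by rewrite mul1r.
by rewrite exprS -mulrA; apply: power_span_mul_gen; exact: IHn.
Qed.

Lemma power_span_gen : Q t.
Proof.
by have [_ P1 _] := P_subalg; rewrite -[t]mulr1 -[X in X * _]expr1; exact: power_span_pow.
Qed.

Lemma power_span_ind (P' : A -> Prop) : linear_pred P' ->
  (forall a b, Q a -> P' a -> P' b -> P' (a * b)) -> P' 1 -> P' t ->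
  (forall a, P a -> P' a) -> forall a, Q a -> P' a.
Proof.
move=> P'lin P'M P'1 P't PP' _ [F PF ->]; apply: linear_pred_sum => // i.
have [_ P1 _] := P_subalg.
elim: (nat_of_ord i) => [|n IHn]; first by rewrite mul1r; auto.
by rewrite exprS -mulrA; apply: P'M => //; exact: power_span_gen.
Qed.
End PowerSpan.
End GeneratedSubalgebras.

Lemma tensorvM (k : fieldType) (A : falgType k) (R : {aspace A}) (s t : tensor A A) :
  s \in tensorv R R -> t \in tensorv R R -> s * t \in tensorv R R.
Proof.
move=> sRR tRR; move: s sRR; apply: span_linear_pred => [|_ /allpairsP[[a b] /= [aR bR ->]]].
  split=> [|s s' Ps Ps'|c s Ps]; rewrite ?mul0r ?mem0v //.
    by rewrite mulrDl memvD.
  by rewrite -scalerAl memvZ.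
move: t tRR; apply: span_linear_pred => [|_ /allpairsP[[c d] /= [cR dR ->]]].
  split=> [|s s' Ps Ps'|c s Ps]; rewrite ?mulr0 ?mem0v //.
    by rewrite mulrDr memvD.
  by rewrite -scalerAr memvZ.
by rewrite pureM mem_tensorv ?memvM ?vbasis_mem.
Qed.

(** * Contraction of the coproduct against a functional *)

Section Contraction.
Variables (k : fieldType) (C : falgType k) (h : hopf_structure C).
Local Notation Δ := (comul h).

Definition translate (φ : {linear C -> k^o}) (b a : C) : k^o := φ (b * a).

Fact translate_is_linear φ b : linear (translate φ b).
Proof. by move=> c a a'; rewrite /translate mulrDr -scalerAr linearP. Qed.
HB.instance Definition _ φ b :=
  GRing.isLinear.Build k C k^o *:%R (translate φ b) (translate_is_linear φ b).

(** The left translation-invariant operator a |-> Σ φ(a2) a1. It is a derivation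
    when φ is a derivation at the counit, and lowers the degree of monomials when
    φ vanishes at 1. *)
Definition contract (φ : {linear C -> k^o}) : C -> C :=
  tlift (fun a b => (φ b : k) *: a) \o Δ.

HB.instance Definition _ φ := GRing.Linear.copy (contract φ)
  (tlift (fun a b => (φ b : k) *: a) \o Δ).

Lemma eq_contract (φ φ' : {linear C -> k^o}) a :
  φ =1 φ' -> contract φ a = contract φ' a.
Proof. by move=> e; apply: eq_tlift => b c; rewrite e. Qed.

Lemma contract1 (φ : {linear C -> k^o}) : contract φ 1 = (φ 1 : k)%:A.
Proof. by rewrite /contract /= rmorph1 tliftE //; exact: (bilinear_scaler φ idfun). Qed.

Let contract_pure (φ : {linear C -> k^o}) a b m :
  tlift (fun a b => (φ b : k) *: a) ((a ⊗ b) * Δ m) =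
  a * contract (translate φ b) m.
Proof.
rewrite /contract /=; elim/tensor_ind: (Δ m) => [c d | s t IHs IHt].
  rewrite pureM [LHS](tliftE (bilinear_scaler φ idfun)).
  by rewrite (tliftE (bilinear_scaler (translate φ b) idfun)) /= scalerAr.
by rewrite mulrDr !linearD /= IHs IHt mulrDr.
Qed.

Lemma contract_grouplike φ g m : Δ g = g ⊗ g ->
  contract φ (g * m) = g * contract (translate φ g) m.
Proof. by move=> Δg; rewrite {1}/contract /= rmorphM /= Δg contract_pure. Qed.

Lemma contract_skew_primitive φ g a m : Δ a = a ⊗ 1 + g ⊗ a ->
  contract φ (a * m) = a * contract φ m + g * contract (translate φ a) m.
Proof.
move=> Δa; rewrite {1}/contract /= rmorphM /= Δa mulrDl linearD /= !contract_pure.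
congr (_ * _ + _); rewrite /contract /=.
by apply: eq_tlift => c d; rewrite /translate mul1r.
Qed.
End Contraction.

(** * Independence of the ordered monomials in primitive elements *)

Section PrimitiveWords.
Variables (k : fieldType) (C : falgType k) (h : hopf_structure C).
Variables (I : eqType) (x : I -> C) (φ : I -> {linear C -> k^o}).
Hypothesis x_primitive : forall s, comul h (x s) = x s ⊗ 1 + 1 ⊗ x s.
Hypothesis φ1 : forall s, φ s 1 = 0.
Hypothesis φx : forall s t, φ s (x t) = (s == t)%:R.

Definition word_prod (w : seq I) : C := \prod_(s <- w) x s.
Local Notation m := word_prod.

(** The span of the products of fewer than n letters, stated as the smallest
    linear predicate containing them, so that linear properties are proved on it by
    instantiation. *)
Definition word_span (n : nat) (a : C) : Prop :=
  forall P : C -> Prop, linear_pred P -> (forall w, (size w < n)%N -> P (m w)) -> P a.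

Lemma word_span_linear n : linear_pred (word_span n).
Proof.
split=> [P [P0 PD PZ] _ | a b Va Vb P Plin Pw | c a Va P Plin Pw] //.
  by have [_ PD _] := Plin; apply: PD; [exact: (Va P) | exact: (Vb P)].
by have [_ _ PZ] := Plin; apply: PZ; exact: (Va P).
Qed.

Lemma word_span_word n w : (size w < n)%N -> word_span n (m w).
Proof. by move=> ltwn P _; apply. Qed.

Lemma word_span_mul n s a : word_span n a -> word_span n.+1 (x s * a).
Proof.
move=> Va P [P0 PD PZ] Pw; apply: (Va (fun a => P (x s * a))).
  split=> [|b b'|z b]; rewrite ?mulr0 ?mulrDr -?scalerAr; auto.
by move=> w ltwn; have := Pw (s :: w) ltwn; rewrite /m big_cons.
Qed.

Lemma word_span_le n n' a : (n <= n')%N -> word_span n a -> word_span n' a.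
Proof.
move=> len Va P Plin Pw; apply: (Va P) => // w ltw; apply: Pw; exact: leq_trans len.
Qed.

Lemma word_span0 a : word_span 0 a -> a = 0.
Proof.
move=> Va; apply: (Va (fun a => a = 0)) => //.
split=> // [b c -> ->|z b ->]; first by rewrite addr0.
exact: scaler0.
Qed.

(** The sum over the letters s of w of ψ (x s) times the word with that letter
    erased. *)
Fixpoint word_deriv (ψ : C -> k) (w : seq I) : C :=
  if w is s :: w' then ψ (x s) *: m w' + x s * word_deriv ψ w' else 0.

Lemma word_deriv_span ψ w : word_span (size w) (word_deriv ψ w).
Proof.
elim: w => [|s w IHw] /=; first by have [] := word_span_linear 0.
have [_ VD VZ] := word_span_linear (size w).+1.
by apply: VD; [apply: VZ; exact: word_span_word | exact: word_span_mul].
Qed.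

(** In the coproduct of a product of primitive elements each letter goes to one of
    the two factors. Sending no letter or one letter to ψ gives the two displayed
    terms, and the others are shorter by at least two letters. *)
Lemma contract_word (ψ : {linear C -> k^o}) w :
  word_span (size w).-1
    (contract h ψ (m w) - ((ψ 1 : k) *: m w + word_deriv ψ w)).
Proof.
elim: w ψ => [|s w IHw] ψ /=.
  rewrite /m big_nil contract1 addr0 subrr.
  by have [] := word_span_linear 0.
rewrite [m (s :: w)]/m big_cons -/(m w) (contract_skew_primitive _ _ (x_primitive s)).
rewrite mul1r.
have := IHw ψ; have := IHw (translate ψ (x s)).
set d := contract _ _ _; set d' := contract _ _ _; rewrite /= /translate mulr1.
set e := word_deriv _ w; set e' := word_deriv _ w => Ve Ve'.
have [_ VD VZ] := word_span_linear (size w).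
have {}Ve : word_span (size w) (d - (ψ (x s) : k) *: m w).
  have -> : d - (ψ (x s) : k) *: m w = (d - ((ψ (x s) : k) *: m w + e)) + e.
    by rewrite opprD addrA subrK.
  apply: VD; last exact: word_deriv_span.
  exact: word_span_le (leq_pred _) Ve.
have {}Ve' : word_span (size w) (x s * (d' - ((ψ 1 : k) *: m w + e'))).
  case: (w) Ve' => [|t w'] /=; last exact: word_span_mul.
  by move/word_span0->; rewrite mulr0; have [] := word_span_linear 0.
rewrite [X in word_span _ X](_ : _ = (d - (ψ (x s) : k) *: m w)
  + x s * (d' - ((ψ 1 : k) *: m w + e'))); first exact: VD.
rewrite mulrBr mulrDr -scalerAr; set A := x s * d'; set B := _ *: (x s * _).
set E := x s * e'; rewrite !opprD !addrA; congr (_ - E).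
by rewrite (addrC A) -[RHS]addrA [RHS]addrAC addrA.
Qed.

(** The convolution product of the φ s for s in v. Its value on a word of the same
    length counts the ways of matching the letters of the two words, and it vanishes
    on shorter words. *)
Fixpoint pairing (v : seq I) : {linear C -> k^o} :=
  if v is s :: v' then pairing v' \o contract h (φ s) else counit h.

(** The product of the factorials of the numbers of occurrences in v. *)
Fixpoint multiplicity (v : seq I) : nat :=
  if v is s :: v' then (count_mem s v * multiplicity v')%N else 1%N.

Let pairing_span0 v a :
  (forall w, (size w < size v)%N -> pairing v (m w) = 0) ->
  word_span (size v) a -> pairing v a = 0.
Proof.
move=> v0 Va; apply: (Va (fun a => pairing v a = 0)) => //.
split=> [|b c b0 c0|z b b0]; first exact: linear0.
  by rewrite linearD b0 c0 addr0.
by rewrite linearZ b0 /= scaler0.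
Qed.

(* The prefix [pre] is what allows an induction on w: erased letters are
   looked for in w only. *)
Let pairing_deriv v s pre w :
  (forall w, (size w <= size v)%N ->
    pairing v (m w) = (if perm_eq v w then multiplicity v else 0)%:R) ->
  (size pre + size w = (size v).+1)%N ->
  pairing v (m pre * word_deriv (φ s) w) =
  (if perm_eq (s :: v) (pre ++ w) then count_mem s w * multiplicity v else 0)%N%:R.
Proof.
move=> vm; elim: w pre => [|t w IHw] pre /= szw.
  by rewrite mulr0 linear0; case: ifP.
rewrite mulrDr linearD -scalerAr linearZ /= φx.
rewrite [X in _ *: pairing v X](_ : _ = m (pre ++ w)); last by rewrite /m big_cat.
rewrite vm ?size_cat; last by rewrite -ltnS -szw addnS.
rewrite mulrA [X in pairing v (X * _)](_ : _ = m (rcons pre t)); last first.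
  by rewrite /m -cats1 big_cat big_seq1.
rewrite IHw ?size_rcons ?addSnnS // cat_rcons.
have -> : perm_eq (s :: v) (pre ++ t :: w) = perm_eq (s :: v) (t :: pre ++ w).
  by rewrite !(perm_sym (s :: v)) -cat1s perm_catCA.
rewrite (eq_sym t s); have [<- | _] := eqVneq s t; last first.
  by rewrite scale0r add0r; case: ifP.
rewrite perm_cons scale1r.
case: ifP => _; rewrite ?addr0 // -natrD.
by rewrite mulnDl mul1n.
Qed.

(** Each contraction erases one letter up to words that the remaining contractions
    kill for degree reasons. *)
Lemma pairing_word v w : (size w <= size v)%N ->
  pairing v (m w) = (if perm_eq v w then multiplicity v else 0)%:R.
Proof.
elim: v w => [|s v IHv] w /=.
  by rewrite leqn0 => /nilP->; rewrite /m big_nil rmorph1.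
move=> szw; have v0 w' : (size w' < size v)%N -> pairing v (m w') = 0.
  move=> ltw; rewrite IHv 1?ltnW //; case: ifP => // /perm_size szv.
  by rewrite -szv ltnn in ltw.
have := @contract_word (φ s) w; rewrite φ1 scale0r add0r => Vw.
have szpred : ((size w).-1 <= size v)%N by case: (size w) szw.
have /eqP := pairing_span0 v0 (word_span_le szpred Vw).
rewrite linearB subr_eq0 => /eqP->.
move: szw; rewrite leq_eqVlt => /orP[/eqP szw | ltw].
  rewrite -[word_deriv _ _]mul1r -[1](_ : m [::] = 1) ?pairing_deriv //; last by rewrite /m big_nil.
  rewrite cat0s; case: ifP => // /permP/(_ (pred1 s)) <- //.
rewrite (pairing_span0 v0); last by apply: word_span_le (@word_deriv_span _ w).
by case: ifP => // /perm_size /= szv; rewrite -szv ltnn in ltw.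
Qed.

Lemma multiplicity_neq0 p v : p \in [pchar k] ->
  (forall s, count_mem s v < p)%N -> (multiplicity v)%:R != 0 :> k.
Proof.
move=> pch; elim: v => [|s v IHv] cv; first exact: oner_neq0.
rewrite /= natrM mulf_neq0 ?IHv // => [|t].
  rewrite -(dvdn_pcharf pch) gtnNdvd ?eqxx //; have := cv s.
  by rewrite /= eqxx.
by apply: leq_ltn_trans (cv t); rewrite /= leq_addl.
Qed.

(** The pairing against a longest word of a linear relation isolates its
    coefficient, up to a product of factorials of integers below p. *)
Lemma primitive_words_free (p : nat) (K : finType) (w : K -> seq I) :
  p \in [pchar k] ->
  (forall α s, count_mem s (w α) < p)%N ->
  (forall α β, perm_eq (w α) (w β) -> α = β) ->
  forall c : K -> k, \sum_α c α *: m (w α) = 0 -> forall α, c α = 0.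
Proof.
move=> pch w_lt w_inj c c0 α0; apply/eqP/negPn/negP => cα0.
case: (arg_maxnP (P := fun β => c β != 0) (fun β => size (w β)) cα0) => α /= cα α_max.
have := congr1 (pairing (w α)) c0; rewrite linear0 linear_sum (bigD1 α) //=.
rewrite big1 => [|β neq_βα].
  rewrite addr0 linearZ pairing_word // perm_refl /= => cm0.
  have /eqP : c α * (multiplicity (w α))%:R = 0 by exact: cm0.
  have mn0 := multiplicity_neq0 pch (w_lt α).
  by rewrite mulf_eq0 (negPf cα) (negPf mn0).
rewrite linearZ /=; have [-> | cβ] := eqVneq (c β) 0; first by rewrite scale0r.
rewrite pairing_word ?α_max //; case: ifP => [/w_inj eq_αβ | _]; last exact: scaler0.
by rewrite eq_αβ eqxx in neq_βα.
Qed.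
End PrimitiveWords.

(** * The restricted enveloping algebra of sl2 *)

Section Sl2Matrices.
Variable k : fieldType.

Definition sl2_E : 'M[k]_2 := delta_mx 0 1.
Definition sl2_F : 'M[k]_2 := delta_mx 1 0.
Definition sl2_H : 'M[k]_2 := delta_mx 0 0 - delta_mx 1 1.
Local Notation E := sl2_E.
Local Notation F := sl2_F.
Local Notation H := sl2_H.

Lemma mx2_oneE : 1 = delta_mx 0 0 + delta_mx 1 1 :> 'M[k]_2.
Proof.
apply/matrixP=> i j; rewrite !mxE.
by case: i j => [[|[|[]]] //= ?] [[|[|[]]] //= ?]; rewrite ?addr0 ?add0r.
Qed.

Let delta_mul (a b c d : 'I_2) : delta_mx a b * delta_mx c d =
  (if b == c then delta_mx a d else 0) :> 'M[k]_2.
Proof.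
rewrite -[LHS]/(_ *m _); case: eqVneq => [->|]; first exact: mul_delta_mx.
exact: mul_delta_mx_0.
Qed.

Lemma sl2_mulEE : E * E = 0. Proof. by rewrite delta_mul. Qed.
Lemma sl2_mulFF : F * F = 0. Proof. by rewrite delta_mul. Qed.
Lemma sl2_mulEF : E * F = delta_mx 0 0. Proof. by rewrite delta_mul. Qed.
Lemma sl2_mulFE : F * E = delta_mx 1 1. Proof. by rewrite delta_mul. Qed.
Lemma sl2_mulHE : H * E = E. Proof. by rewrite mulrBl !delta_mul /= subr0. Qed.
Lemma sl2_mulEH : E * H = - E. Proof. by rewrite mulrBr !delta_mul /= sub0r. Qed.
Lemma sl2_mulHF : H * F = - F. Proof. by rewrite mulrBl !delta_mul /= sub0r. Qed.
Lemma sl2_mulFH : F * H = F. Proof. by rewrite mulrBr !delta_mul /= subr0. Qed.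
Lemma sl2_mulHH : H * H = 1.
Proof.
by rewrite mulrBl !mulrBr !delta_mul /= subr0 sub0r opprK -mx2_oneE.
Qed.

Lemma sl2_E_exp p : (1 < p)%N -> E ^+ p = 0.
Proof. by case: p => [|[|p]] // _; rewrite !exprS mulrA sl2_mulEE mul0r. Qed.

Lemma sl2_F_exp p : (1 < p)%N -> F ^+ p = 0.
Proof. by case: p => [|[|p]] // _; rewrite !exprS mulrA sl2_mulFF mul0r. Qed.

Lemma sl2_H_exp p : odd p -> H ^+ p = H.
Proof.
move=> p_odd; rewrite -(odd_double_half p) p_odd -mul2n exprS exprM expr2 sl2_mulHH.
by rewrite expr1n mulr1.
Qed.

Lemma mem_sl2_E : E \in sl2 k.
Proof. by rewrite mem_sl2 /mxtrace !big_ord_recl big_ord0 !mxE /= !addr0. Qed.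

Lemma mem_sl2_F : F \in sl2 k.
Proof. by rewrite mem_sl2 /mxtrace !big_ord_recl big_ord0 !mxE /= !addr0. Qed.

Lemma mem_sl2_H : H \in sl2 k.
Proof.
rewrite mem_sl2 /mxtrace !big_ord_recl big_ord0 !mxE /=.
by rewrite subr0 sub0r addr0 subrr.
Qed.
End Sl2Matrices.

Lemma two_neq0 (k : fieldType) (p : nat) :
  p \in [pchar k] -> (2 < p)%N -> 2%:R != 0 :> k.
Proof. by move=> p_char p_gt2; rewrite -(dvdn_pcharf p_char) gtnNdvd. Qed.

Lemma half_expp (k : fieldType) (p : nat) :
  p \in [pchar k] -> (2%:R^-1 : k) ^+ p = 2%:R^-1.
Proof. by move=> p_char; rewrite exprVn -(pFrobenius_autE p_char) rmorph_nat. Qed.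

Section EnvelopingSl2.
Variables (k : fieldType) (p : nat).
Hypotheses (p_char : p \in [pchar k]) (p_gt2 : (2 < p)%N).
Variables (U : falgType k) (hU : hopf_structure U).
Variable j : {linear subvs_of (sl2 k) -> U}.
Hypothesis U_usl2 : is_restricted_enveloping_sl2 p hU j.
Local Notation E := (sl2_E k).
Local Notation F := (sl2_F k).
Local Notation H := (sl2_H k).

Let p_odd : odd p.
Proof.
by case: (even_prime (pcharf_prime p_char)) p_gt2 => // ->.
Qed.

(* In terms of the standard basis, y is e, zeta is h / 2 and v is f / 2. *)
Definition usl2_y : U := j (vsproj (sl2 k) E).
Definition usl2_zeta : U := 2%:R^-1 *: j (vsproj (sl2 k) H).
Definition usl2_v : U := 2%:R^-1 *: j (vsproj (sl2 k) F).
Local Notation Y := usl2_y.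
Local Notation Z := usl2_zeta.
Local Notation V := usl2_v.

Let jE := vsprojK (mem_sl2_E k).
Let jF := vsprojK (mem_sl2_F k).
Let jH := vsprojK (mem_sl2_H k).

Let bracket (a b : 'M[k]_2) : a \in sl2 k -> b \in sl2 k ->
  j (vsproj (sl2 k) a) * j (vsproj (sl2 k) b) =
  j (vsproj (sl2 k) b) * j (vsproj (sl2 k) a) + j (vsproj (sl2 k) (a * b - b * a)).
Proof.
move=> asl bsl; have [jb _] := usl2_rel U_usl2.
have := jb (vsproj _ a) (vsproj _ b).
by rewrite /sl2_bracket /= (vsprojK asl) (vsprojK bsl) => ->; rewrite addrC subrK.
Qed.

Let jpow (a : 'M[k]_2) : a \in sl2 k ->
  j (vsproj (sl2 k) a) ^+ p = j (vsproj (sl2 k) (a ^+ p)).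
Proof.
move=> asl; have [_ jp] := usl2_rel U_usl2.
by rewrite -jp /sl2_pmap /= (vsprojK asl).
Qed.

(** Setting g = 1 and x = u = 0 turns the relations of the double into the
    restricted relations of sl2 for e, h / 2 and f / 2; this is what defines the
    quotient map. *)
Lemma usl2_double_relations : double_relations p 0 V Z 1 0 Y.
Proof.
have p_gt0 : (0 < p)%N by apply: leq_trans p_gt2.
have p_gt1 : (1 < p)%N by apply: leq_trans p_gt2.
have half2 : 2%:R^-1 * 2%:R = 1 :> k by rewrite mulVf ?(two_neq0 p_char).
have jD a : j (vsproj (sl2 k) (a + a)) = 2%:R *: j (vsproj (sl2 k) a).
  by rewrite !linearD /= scaler_nat mulr2n.
split; rewrite ?(expr0n, expr1n, gtn_eqF p_gt0, mul0r, mulr0, mul1r, mulr1,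
  addr0, subrr, scaler0) //.
- by rewrite /Y jpow ?mem_sl2_E // sl2_E_exp // !linear0.
- by rewrite /Z exprZn half_expp // jpow ?mem_sl2_H // sl2_H_exp.
- by rewrite /V exprZn jpow ?mem_sl2_F // sl2_F_exp // !linear0.
- rewrite /V /Z -!scalerAl -!scalerAr !scalerA bracket ?mem_sl2_F ?mem_sl2_H //.
  by rewrite sl2_mulHF sl2_mulFH opprK jD scalerDr scalerA -mulrA half2 mulr1.
- rewrite /Z /Y -!scalerAl -!scalerAr bracket ?mem_sl2_E ?mem_sl2_H //.
  by rewrite sl2_mulHE sl2_mulEH opprK jD scalerDr scalerA half2 scale1r.
- rewrite /V /Y /Z -!scalerAl -!scalerAr bracket ?mem_sl2_F ?mem_sl2_E //.
  by rewrite sl2_mulFE sl2_mulEF -opprB !linearN /= scalerDr scalerN.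
Qed.

Lemma usl2_generated : agenv <<[:: Y; Z; V]>> = {:U}%VS.
Proof.
apply/eqP; rewrite eqEsubv subvf -(usl2_gen U_usl2) agenvS //.
apply/subvP=> _ /memv_imgP[a _ ->]; rewrite lfunE /=.
have two0 := two_neq0 p_char p_gt2.
have aE : a = vsval a 0 1 *: vsproj (sl2 k) E + vsval a 0 0 *: vsproj (sl2 k) H
    + vsval a 1 0 *: vsproj (sl2 k) F.
  apply: subvs_inj; rewrite 2!linearD 3!linearZ /= jE jF jH.
  have := valP a; rewrite /= mem_sl2 /mxtrace !big_ord_recl big_ord0 addr0.
  have -> : lift ord0 ord0 = 1 :> 'I_2 by apply: val_inj.
  rewrite addrC addr_eq0 => /eqP/esym tra.
  apply/matrixP=> i l; rewrite !mxE.
  case: i l => [[|[|[]]] //= ?] [[|[|[]]] //= ?];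
    rewrite ?(subr0, sub0r, mulr0, mulr1, mulrN, add0r, addr0) ?tra;
    by congr (fun_of_matrix _ _ _); apply: val_inj.
rewrite [X in j X]aE 2!linearD 3!linearZ /=.
have in_span s : s \in [:: Y; Z; V] -> s \in <<[:: Y; Z; V]>>%VS by exact: memv_span.
have HZ : j (vsproj (sl2 k) H) \in <<[:: Y; Z; V]>>%VS.
  rewrite (_ : j _ = 2%:R *: Z); last by rewrite scalerA divff // scale1r.
  by apply/memvZ/in_span; rewrite !inE eqxx orbT.
have FV : j (vsproj (sl2 k) F) \in <<[:: Y; Z; V]>>%VS.
  rewrite (_ : j _ = 2%:R *: V); last by rewrite scalerA divff // scale1r.
  by apply/memvZ/in_span; rewrite !inE eqxx !orbT.
by rewrite !memvD ?memvZ // in_span // inE eqxx.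
Qed.

(** The bracket and the p-map of sl2 are those of 2 x 2 matrices, so the inclusion
    of sl2 extends to the restricted enveloping algebra. *)
Lemma usl2_rep : exists rho : {lrmorphism U -> 'M[k]_2}, 
  [/\ rho Y = E, rho Z = 2%:R^-1 *: H & rho V = 2%:R^-1 *: F].
Proof.
pose j' : {linear subvs_of (sl2 k) -> 'M[k]_2} :=
  HB.pack (vsval : subvs_of (sl2 k) -> 'M[k]_2)
    (GRing.isLinear.Build k _ 'M[k]_2 *:%R _ (@vsval_is_linear k _ (sl2 k))).
have [rho rhoj] : exists rho : {lrmorphism U -> 'M[k]_2}, forall a, rho (j a) = j' a.
  apply: usl2_univ U_usl2 _ _ _; split=> a * /=.
    exact: val_sl2_bracket.
  exact: val_sl2_pmap.
by exists rho; rewrite !linearZ /= !rhoj /= !vsprojK ?mem_sl2_E ?mem_sl2_F ?mem_sl2_H.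
Qed.

Lemma usl2_primitive :
  [/\ comul hU Y = Y ⊗ 1 + 1 ⊗ Y, comul hU Z = Z ⊗ 1 + 1 ⊗ Z
    & comul hU V = V ⊗ 1 + 1 ⊗ V].
Proof.
have ΔZ a : comul hU (2%:R^-1 *: j a) = (2%:R^-1 *: j a) ⊗ 1 + 1 ⊗ (2%:R^-1 *: j a).
  by rewrite linearZ /= (usl2_comul U_usl2) pureZl linearZ scalerDr.
by split; [exact: (usl2_comul U_usl2) | exact: ΔZ | exact: ΔZ].
Qed.

(** The matrix entries of the tautological representation, taken modulo the scalar
    matrices, are functionals that vanish at 1 and are dual to y, zeta and v. Hence
    y, zeta and v are primitive elements to which the independence of words applies. *)
Lemma usl2_pbw_free (c : 'I_p * 'I_p * 'I_p -> k) :
  \sum_α c α *: (Y ^+ α.1.1 * Z ^+ α.1.2 * V ^+ α.2) = 0 -> forall α, c α = 0.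
Proof.
have two0 := two_neq0 p_char p_gt2.
have [rho [rhoY rhoZ rhoV]] := usl2_rep; have [ΔY ΔZ ΔV] := usl2_primitive.
pose x (s : option bool) := match s with Some true => Y | None => Z | Some false => V end.
pose entry (M : 'M[k]_2) (s : option bool) : k := match s with
  | Some true => M 0 1 | None => M 0 0 - M 1 1 | Some false => 2%:R * M 1 0 end.
have entry_lin s : linear (fun a : U => entry (rho a) s : k^o).
  move=> z a b; rewrite linearP; case: s => [[]|]; rewrite /entry !mxE //.
    by rewrite mulrDr mulrCA.
  by rewrite opprD addrACA scalerBr.
pose φ s : {linear U -> k^o} :=
  HB.pack (fun a : U => entry (rho a) s : k^o)
    (GRing.isLinear.Build k U k^o *:%R _ (entry_lin s)).
pose w (α : 'I_p * 'I_p * 'I_p) :=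
  nseq α.1.1 (Some true) ++ nseq α.1.2 None ++ nseq α.2 (Some false).
have wE α : word_prod x (w α) = Y ^+ α.1.1 * Z ^+ α.1.2 * V ^+ α.2.
  by rewrite /word_prod !big_cat /= !big_nseq -!Monoid.iteropE mulrA.
have w_count α s : count_mem s (w α) =
    match s with Some true => α.1.1 | None => α.1.2 | Some false => α.2 end :> nat.
  rewrite !count_cat !count_nseq; case: s => [[]|] /=; by rewrite ?mul1n ?mul0n ?addn0.
have half2 : 2%:R^-1 + 2%:R^-1 = 1 :> k.
  by rewrite -[RHS](mulVf two0) mulr_natr mulr2n.
move=> c0; apply: (@primitive_words_free k U hU _ x φ _ _ _ p _ w p_char).
- by case=> [[]|].
- by move=> s; rewrite /= /entry rmorph1; case: s => [[]|]; rewrite !mxE /= ?mulr0 ?subrr.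
- move=> s t /=; case: t => [[]|] /=; rewrite ?rhoY ?rhoZ ?rhoV /entry;
    case: s => [[]|]; rewrite !mxE /=;
    rewrite ?(subr0, sub0r, mulr0, mulr1, mulrN, opprK) ?mulfV ?half2 //.
- move=> [[a b] d] s; rewrite w_count; by case: s => [[]|] /=.
- move=> [[a b] d] [[a' b'] d'] /permP e.
  have := e (pred1 (Some true)); have := e (pred1 None); have := e (pred1 (Some false)).
  by rewrite !w_count /= => /val_inj-> /val_inj-> /val_inj->.
- by rewrite -[RHS]c0; apply: eq_bigr => α _; rewrite wE.
Qed.
End EnvelopingSl2.

(** * A representation of the double over the dual numbers *)

Section DualNumberMatrices.
Variable k : fieldType.

(** The matrix A + ε B over the dual numbers k[ε] / ε^2. *)
Definition dual_mx (A B : 'M[k]_2) : 'M[k]_4 := block_mx A B 0 A : 'M[k]_(2 + 2).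

Lemma dual_mxM A B C D :
  dual_mx A B * dual_mx C D = dual_mx (A * C) (A * D + B * C).
Proof.
transitivity (mulmx (block_mx A B 0 A) (block_mx C D 0 C) : 'M[k]_(2 + 2)) => //.
by rewrite mulmx_block /dual_mx !mulmx0 !mul0mx !addr0 add0r.
Qed.

Lemma dual_mxD A B C D : dual_mx A B + dual_mx C D = dual_mx (A + C) (B + D).
Proof.
transitivity (block_mx A B 0 A + block_mx C D 0 C : 'M[k]_(2 + 2)) => //.
by rewrite add_block_mx addr0.
Qed.

Lemma dual_mxZ c A B : c *: dual_mx A B = dual_mx (c *: A) (c *: B).
Proof.
transitivity (c *: block_mx A B 0 A : 'M[k]_(2 + 2)) => //.
by rewrite scale_block_mx scaler0.
Qed.

Lemma dual_mxN A B : - dual_mx A B = dual_mx (- A) (- B).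
Proof. by rewrite -!scaleN1r dual_mxZ. Qed.

Lemma dual_mx1 : dual_mx 1 0 = 1.
Proof. by rewrite /dual_mx -scalar_mx_block. Qed.

Lemma dual_mx0 : dual_mx 0 0 = 0.
Proof. by rewrite /dual_mx block_mx0. Qed.

Lemma dual_mx_exp1 A n : dual_mx 1 A ^+ n = dual_mx 1 (n%:R *: A).
Proof.
elim: n => [|n IHn]; first by rewrite expr0 scale0r dual_mx1.
by rewrite exprS IHn dual_mxM !mul1r mulr1 -natr1 scalerDl scale1r.
Qed.

Lemma dual_mx_exp A n : dual_mx A 0 ^+ n = dual_mx (A ^+ n) 0.
Proof.
elim: n => [|n IHn]; first by rewrite !expr0 dual_mx1.
by rewrite !exprS IHn dual_mxM mulr0 mul0r addr0.
Qed.

Local Notation E := (sl2_E k).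
Local Notation F := (sl2_F k).
Local Notation H := (sl2_H k).

(** Modulo ε this is the standard representation of sl2. The elements g - 1, x and
    u act by ε times h, 2 e and f, a copy of the adjoint representation. The factor
    1 - ε in v is forced by the relation between v and y, in which g zeta and y u
    contribute the terms ε h^2 / 2 and ε e f. *)
Definition rep_g := dual_mx 1 H.
Definition rep_x := dual_mx 0 (2%:R *: E).
Definition rep_u := dual_mx 0 F.
Definition rep_y := dual_mx E 0.
Definition rep_zeta := dual_mx (2%:R^-1 *: H) 0.
Definition rep_v := dual_mx (2%:R^-1 *: F) (- (2%:R^-1 *: F)).

Lemma rep_relations p : p \in [pchar k] -> (2 < p)%N ->
  double_relations p rep_u rep_v rep_zeta rep_g rep_x rep_y.
Proof.
move=> p_char p_gt2.
have two0 := two_neq0 p_char p_gt2.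
have half2 : 2%:R^-1 * 2%:R = 1 :> k by rewrite mulVf.
have halfD : 2%:R^-1 + 2%:R^-1 = 1 :> k by rewrite -[RHS]half2 mulr_natr mulr2n.
have p_odd : odd p by case: (even_prime (pcharf_prime p_char)) p_gt2 => // ->.
have p_gt1 : (1 < p)%N by apply: leq_trans p_gt2.
have sq0 (M : 'M[k]_4) : M * M = 0 -> M ^+ p = 0.
  by case: p p_gt1 {p_char p_gt2 p_odd} => [|[|q]] // _ M0; rewrite !exprS mulrA M0 mul0r.
have dual_eq A B C D : A = C -> B = D -> dual_mx A B = dual_mx C D by move=> -> ->.
pose simp := (expr2, dual_mxM, dual_mxZ, dual_mxN, dual_mxD, mul0r, mulr0, mul1r, mulr1,
  addr0, add0r, subr0, sub0r, subrr, oppr0, scaler0, mulrN, mulNr).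
pose comp := (sl2_mulEE k, sl2_mulFF k, sl2_mulHE k, sl2_mulEH k, sl2_mulHF k,
  sl2_mulFH k, sl2_mulHH k, sl2_mulEF k, sl2_mulFE k).
have scl (c : k) (A B : 'M[k]_2) : (c *: A) * B = c *: (A * B) by rewrite scalerAl.
have scr (c : k) (A B : 'M[k]_2) : A * (c *: B) = c *: (A * B) by rewrite scalerAr.
have halves (A : 'M[k]_2) : A = 2%:R^-1 *: A + 2%:R^-1 *: A by rewrite -scalerDl halfD scale1r.
have quarters (A : 'M[k]_2) : 2%:R^-1 *: A = (2%:R^-1 / 2%:R) *: A + (2%:R^-1 / 2%:R) *: A.
  by rewrite -scalerDl -mulrDr halfD mulr1.
rewrite /rep_g /rep_x /rep_u /rep_y /rep_zeta /rep_v.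
split; try (apply: sq0); rewrite -?dual_mx1 -?dual_mx0 ?simp.
all: try (apply: dual_eq; rewrite ?(scl, scr) ?comp ?(scalerN, scalerA)
  ?(half2, mulfV two0, scale1r, scaler0, oppr0, subr0, opprK) //).
- by rewrite dual_mx_exp1 (pcharf0 p_char) scale0r.
- by rewrite scaler_nat mulr2n addKr.
- by rewrite dual_mx_exp exprZn half_expp // sl2_H_exp.
- by apply/eqP; rewrite eq_sym addrC subr_eq -quarters.
- by apply/eqP; rewrite eq_sym subr_eq eq_sym addrC subr_eq -quarters.
- by apply/eqP; rewrite eq_sym addrC subr_eq -halves.
- by apply/eqP; rewrite eq_sym addrC subr_eq -halves.
- by rewrite scaler_nat mulr2n addKr.
- by rewrite subrr -opprD -halves addNr.
- by rewrite /sl2_H opprB addrC subrK.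
- by rewrite /sl2_H opprB addrC subrK.
- by rewrite -scalerBr /sl2_H opprB addrC subrK.
- rewrite mx2_oneE scalerDr opprD addrA -opprD -halves.
  by rewrite addrAC addNr add0r.
Qed.
End DualNumberMatrices.

(** * Independence of the monomials in g, x and u *)

(** An operator that acts like d/dt on the powers of t and leaves the coefficients
    alone kills the coefficient of t^0 and shifts the others, with factors that are
    integers between 1 and p - 1. *)
Lemma lowering_free (k : fieldType) (p : nat) (D : falgType k)
    (δ : {linear D -> D}) (t : D) (n : nat) (F : 'I_n -> D) :
  p \in [pchar k] -> (n <= p)%N ->
  (forall i m, δ (t ^+ m * F i) = m%:R *: (t ^+ m.-1 * F i)) ->
  \sum_(i < n) t ^+ i * F i = 0 -> forall i, F i = 0.
Proof.
move=> p_char; elim: n F => [|n IHn] F len δF.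
  by move=> _ [i lti]; have := lti; rewrite ltn0.
rewrite big_ord_recl mul1r => sum0.
have F0 i : F (lift ord0 i) = 0.
  have ni0 : (i.+1)%:R != 0 :> k.
    rewrite -(dvdn_pcharf p_char) gtnNdvd //; apply: leq_trans len; exact: ltn_ord (lift ord0 i).
  suff /(_ i)/eqP : forall i : 'I_n, (i.+1)%:R *: F (lift ord0 i) = 0.
    by rewrite scaler_eq0 (negPf ni0) => /eqP.
  apply: IHn => [|l m|]; first exact: ltnW.
    by rewrite -scalerAr linearZ /= δF scalerA mulrC -scalerA scalerAr.
  have := congr1 δ sum0; rewrite linear0 linearD linear_sum /=.
  have := δF ord0 0; rewrite mul1r scale0r => ->; rewrite add0r => sum0'.
  rewrite -[RHS]sum0'; by apply: eq_bigr => l _; rewrite δF -scalerAr.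
move=> i; case: (unliftP ord0 i) => [l -> | ->]; first exact: F0.
by rewrite -[LHS]addr0 -[RHS]sum0; congr (_ + _); rewrite big1 // => l _; rewrite F0 mulr0.
Qed.

Section DoubleR.
Variables (k : fieldType) (p : nat).
Hypotheses (p_char : p \in [pchar k]) (p_gt2 : (2 < p)%N).
Variables (D : falgType k) (hD : hopf_structure D) (u v zeta g x y : D).
Hypothesis D_double : is_drinfeld_double p hD u v zeta g x y.
Local Notation Δ := (comul hD).
Let rels := double_rel D_double.

Lemma double_dual_rep : exists Φ : {lrmorphism D -> 'M[k]_4},
  [/\ Φ g = rep_g k, Φ x = rep_x k & Φ u = rep_u k].
Proof.
have [Φ [[Φu _ _] [Φg Φx _]]] := double_univ D_double (rep_relations p_char p_gt2).
by exists Φ.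
Qed.

Lemma double_g_unit : g \is a GRing.unit.
Proof.
by rewrite -(unitrX_pos _ (n := p)) ?(rel_gp rels) ?unitr1 // (leq_trans _ p_gt2).
Qed.

Section Contractions.
Variable Φ : {lrmorphism D -> 'M[k]_4}.
Hypotheses (Φg : Φ g = rep_g k) (Φx : Φ x = rep_x k) (Φu : Φ u = rep_u k).

Local Notation K φ := (contract hD (φ \o Φ)).

Let Kg (φ : {linear 'M[k]_4 -> k^o}) a : K φ (g * a) = g * K (translate φ (rep_g k)) a.
Proof.
rewrite (contract_grouplike _ _ (double_comul_g D_double)).
by congr (_ * _); apply: eq_contract => b; rewrite /= /translate rmorphM /= Φg.
Qed.

Let Kx (φ : {linear 'M[k]_4 -> k^o}) a :
  K φ (x * a) = x * K φ a + g * K (translate φ (rep_x k)) a.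
Proof.
rewrite (contract_skew_primitive _ _ (double_comul_x D_double)).
by congr (_ + _ * _); apply: eq_contract => b; rewrite /= /translate rmorphM /= Φx.
Qed.

Let Ku (φ : {linear 'M[k]_4 -> k^o}) a :
  K φ (u * a) = u * K φ a + K (translate φ (rep_u k)) a.
Proof.
rewrite (contract_skew_primitive _ _ (double_comul_u D_double)) mul1r.
by congr (_ + _); apply: eq_contract => b; rewrite /= /translate rmorphM /= Φu.
Qed.

Let exp_pred (t : D) n : n%:R *: (t * t ^+ n.-1) = n%:R *: t ^+ n :> D.
Proof. by case: n => [|n]; rewrite ?scale0r // -exprS. Qed.

Let exp_pred_mul (t w : D) n (c : k) :
  (n%:R * c) *: (t * (t ^+ n.-1 * w)) = (n%:R * c) *: (t ^+ n * w).
Proof. by rewrite mulrA mulrC -!scalerA scalerAl exp_pred -scalerAl. Qed.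

Let repuu : rep_u k * rep_u k = 0.
Proof. by rewrite dual_mxM !mul0r mulr0 addr0 dual_mx0. Qed.
Let repxu : rep_x k * rep_u k = 0.
Proof. by rewrite dual_mxM !mul0r mulr0 addr0 dual_mx0. Qed.
Let repxx : rep_x k * rep_x k = 0.
Proof. by rewrite dual_mxM !mul0r mulr0 addr0 dual_mx0. Qed.
Let repgx : rep_g k * rep_x k = rep_x k.
Proof. by rewrite dual_mxM ?mul1r ?mulr0 ?addr0. Qed.
Let repgu : rep_g k * rep_u k = rep_u k.
Proof. by rewrite dual_mxM ?mul1r ?mulr0 ?addr0. Qed.

Lemma contract_u (φ : {linear 'M[k]_4 -> k^o}) l : K φ (u ^+ l) =
  (φ 1 : k) *: u ^+ l + (l%:R * φ (rep_u k) : k) *: u ^+ l.-1.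
Proof.
elim: l φ => [|l IHl] φ.
  by rewrite expr0 contract1 /= rmorph1 mul0r scale0r addr0.
rewrite exprS Ku !IHl /= /translate mulr1 repuu linear0 mulr0 scale0r addr0.
rewrite mulrDr -!scalerAr -exprS -addrA; congr (_ + _).
rewrite [l%:R * _]mulrC -scalerA exp_pred scalerA -scalerDl.
by rewrite -natr1 mulrDl mul1r mulrC.
Qed.

Lemma contract_xu (φ : {linear 'M[k]_4 -> k^o}) j l : K φ (x ^+ j * u ^+ l) =
  (φ 1 : k) *: (x ^+ j * u ^+ l)
  + (j%:R * φ (rep_x k) : k) *: (g * (x ^+ j.-1 * u ^+ l))
  + (l%:R * φ (rep_u k) : k) *: (x ^+ j * u ^+ l.-1).
Proof.
elim: j φ => [|j IHj] φ; first by rewrite !mul1r contract_u mul0r scale0r addr0.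
rewrite exprS -mulrA Kx !IHj /= /translate mulr1 repxx repxu !linear0 !mulr0 !scale0r !addr0.
have xgC w : x * (g * w) = g * (x * w) by rewrite !mulrA (rel_gx rels).
rewrite !mulrDr -!scalerAr xgC.
have -> : (j%:R * φ (rep_x k)) *: (g * (x * (x ^+ j.-1 * u ^+ l))) =
    (j%:R * φ (rep_x k)) *: (g * (x ^+ j * u ^+ l)).
  by rewrite scalerAr exp_pred_mul -scalerAr.
rewrite addrAC; congr (_ + _); last by rewrite mulrA -exprS.
rewrite -addrA -scalerDl [x * (_ * _)]mulrA -exprS; congr (_ + _ *: _).
by rewrite -natr1 mulrDl mul1r.
Qed.

(** Products of two of the ε-matrices of g - 1, x and u vanish, so the contractions
    behave on monomials as the invariant derivations g d/dg, g d/dx and d/du. The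
    factor g in the second one comes from the coproduct of x. *)
Lemma contract_gxu (φ : {linear 'M[k]_4 -> k^o}) i j l : K φ (g ^+ i * (x ^+ j * u ^+ l)) =
  (φ 1 + i%:R * φ (dual_mx 0 (sl2_H k)) : k) *: (g ^+ i * (x ^+ j * u ^+ l))
  + (j%:R * φ (rep_x k) : k) *: (g ^+ i.+1 * (x ^+ j.-1 * u ^+ l))
  + (l%:R * φ (rep_u k) : k) *: (g ^+ i * (x ^+ j * u ^+ l.-1)).
Proof.
elim: i φ => [|i IHi] φ; first by rewrite !mul1r contract_xu mul0r addr0.
have repgE : rep_g k = 1 + dual_mx 0 (sl2_H k).
  by rewrite -dual_mx1 dual_mxD addr0 add0r.
have repgH : rep_g k * dual_mx 0 (sl2_H k) = dual_mx 0 (sl2_H k).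
  by rewrite dual_mxM ?mul1r ?mulr0 ?addr0.
rewrite exprS -mulrA Kg IHi /= /translate mulr1 repgx repgu repgH !mulrDr -!scalerAr.
rewrite !mulrA -!exprS repgE linearD /=.
congr (_ *: _ + _ + _); rewrite -addrA; congr (_ + _).
by rewrite -natr1 mulrDl mul1r addrC.
Qed.
End Contractions.

(** The variables u, x and g are removed in this order by the derivations dual to
    them; multiplication by g^-1 turns g d/dx and g d/dg into d/dx and d/dg, and the
    matrix 2 e of x accounts for the factor 1/2. *)
Lemma R_monomials_free (c : 'I_p * 'I_p * 'I_p -> k) :
  \sum_α c α *: (g ^+ α.1.1 * (x ^+ α.1.2 * u ^+ α.2)) = 0 -> forall α, c α = 0.
Proof.
have [Φ [Φg Φx Φu]] := double_dual_rep.
have entry_lin (a b : 'I_2) : linear (fun M : 'M[k]_4 => ursubmx (M : 'M_(2 + 2)) a b : k^o).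
  by move=> z M N; rewrite !mxE.
pose entry (a b : 'I_2) : {linear 'M[k]_4 -> k^o} :=
  HB.pack (fun M : 'M[k]_4 => ursubmx (M : 'M_(2 + 2)) a b : k^o)
    (GRing.isLinear.Build k 'M[k]_4 k^o *:%R _ (entry_lin a b)).
have entryE a b A B : entry a b (dual_mx A B) = B a b by rewrite /= block_mxKur.
have entry1 a b : entry a b 1 = 0 by rewrite -dual_mx1 entryE mxE.
pose K (φ : {linear 'M[k]_4 -> k^o}) := contract hD (φ \o Φ).
have Ku m i j : K (entry 1 0) (u ^+ m * (g ^+ i * x ^+ j)) =
    m%:R *: (u ^+ m.-1 * (g ^+ i * x ^+ j)).
  have mC n : u ^+ n * (g ^+ i * x ^+ j) = g ^+ i * (x ^+ j * u ^+ n).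
    rewrite [RHS]mulrA; apply: commrM; apply/commr_sym/commrX/commr_sym/commrX.
      exact: (rel_ug rels).
    exact: (rel_ux rels).
  rewrite !mC /K contract_gxu // entry1 !entryE !mxE /=.
  by rewrite ?(subr0, mulr0, addr0, add0r, scale0r, mulr1).
have Kx m i : (2%:R^-1 : k) *: (g^-1 * K (entry 0 1) (x ^+ m * g ^+ i)) =
    m%:R *: (x ^+ m.-1 * g ^+ i).
  have mC n : x ^+ n * g ^+ i = g ^+ i * (x ^+ n * u ^+ 0).
    by rewrite mulr1; apply/commrX/commr_sym/commrX/(rel_gx rels).
  rewrite !mC /K contract_gxu // entry1 !entryE !mxE /=.
  rewrite ?(subr0, mulr0, addr0, add0r, scale0r, mulr1) -scalerAr exprS -mulrA.
  rewrite mulKr ?double_g_unit //.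
  by rewrite scalerA mulrCA mulVf ?mulr1 ?(two_neq0 p_char).
have Kg m : g^-1 * K (entry 0 0) (g ^+ m) = m%:R *: g ^+ m.-1.
  have := @contract_gxu _ Φg Φx Φu (entry 0 0) m 0 0; rewrite !expr0 !mulr1 /K => ->.
  rewrite entry1 !entryE !mxE /= ?(subr0, mulr1, mul0r, scale0r, addr0, add0r) -scalerAr.
  case: m => [|m]; first by rewrite !scale0r.
  by rewrite exprS mulKr ?double_g_unit.
move=> sum0 [[a b] l].
have {}sum0 : \sum_(l < p) u ^+ l *
    (\sum_(ab : 'I_p * 'I_p) c (ab, l) *: (g ^+ ab.1 * x ^+ ab.2)) = 0.
  transitivity (\sum_(ab : 'I_p * 'I_p) \sum_(l < p)
      c (ab, l) *: (g ^+ ab.1 * (x ^+ ab.2 * u ^+ l))); last first.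
    by rewrite pair_bigA -[RHS]sum0; apply: eq_bigr => -[].
  rewrite exchange_big; apply: eq_bigr => {}l _; rewrite mulr_sumr.
  apply: eq_bigr => -[{}a {}b] _; rewrite -scalerAr mulrA; congr (_ *: _).
  apply: commrM; apply/commr_sym/commrX/commr_sym/commrX.
    exact: (rel_ug rels).
  exact: (rel_ux rels).
have {}sum0 := lowering_free (δ := contract hD (entry 1 0 \o Φ)) p_char (leqnn p) _ sum0.
have {}sum0 : \sum_(ab : 'I_p * 'I_p) c (ab, l) *: (g ^+ ab.1 * x ^+ ab.2) = 0.
  apply: sum0 => {}l m; rewrite mulr_sumr linear_sum mulr_sumr scaler_sumr.
  apply: eq_bigr => -[{}a {}b] _; rewrite -!scalerAr linearZ /= [contract _ _ _]Ku.
  by rewrite !scalerA mulrC.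
have {}sum0 : \sum_(b < p) x ^+ b * (\sum_(a < p) c (a, b, l) *: g ^+ a) = 0.
  transitivity (\sum_(a < p) \sum_(b < p) c (a, b, l) *: (g ^+ a * x ^+ b)); last first.
    by rewrite pair_bigA -[RHS]sum0; apply: eq_bigr => -[].
  rewrite exchange_big; apply: eq_bigr => {}b _; rewrite mulr_sumr.
  apply: eq_bigr => {}a _; rewrite -scalerAr; congr (_ *: _).
  by apply/commrX/commr_sym/commrX/(rel_gx rels).
have {}sum0 := lowering_free (δ := 2%:R^-1 \*: (g^-1 \*o contract hD (entry 0 1 \o Φ)))
  p_char (leqnn p) _ sum0.
have {}sum0 : \sum_(a < p) c (a, b, l) *: g ^+ a = 0.
  apply: sum0 => {}b m; rewrite mulr_sumr linear_sum mulr_sumr scaler_sumr.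
  apply: eq_bigr => {}a _; rewrite -!scalerAr linearZ.
  by rewrite [RHS]scalerA mulrC -scalerA -Kx.
have {}sum0 : \sum_(a < p) g ^+ a * (c (a, b, l))%:A = 0.
  by rewrite -[RHS]sum0; apply: eq_bigr => {}a _; rewrite -scalerAr mulr1.
have := lowering_free (δ := g^-1 \*o contract hD (entry 0 0 \o Φ)) p_char (leqnn p) _ sum0 a.
move=> ca0; have /eqP : (c (a, b, l))%:A = 0 :> D.
  apply: ca0 => {}a m; rewrite -!scalerAr !mulr1 linearZ.
  by rewrite [RHS]scalerA mulrC -scalerA -Kg.
by rewrite scaler_eq0 oner_eq0 orbF => /eqP.
Qed.
End DoubleR.

(** * The subalgebra generated by g, x and u *)

Section SubalgebraR.
Variables (k : fieldType) (p : nat).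
Hypotheses (p_char : p \in [pchar k]) (p_gt2 : (2 < p)%N).
Variables (D : falgType k) (hD : hopf_structure D) (u v zeta g x y : D).
Hypothesis D_double : is_drinfeld_double p hD u v zeta g x y.
Local Notation Δ := (comul hD).
Local Notation ε := (counit hD).
Local Notation S := (antipode hD).
Let rels := double_rel D_double.

Definition double_R : {aspace D} := agenv_aspace <<[:: g; x; u]>>.
Local Notation R := double_R.

Lemma R_gen s : s \in [:: g; x; u] -> s \in R.
Proof. by move=> sX; apply: (subvP (sub_agenv _)); exact: memv_span. Qed.

Lemma R_g : g \in R. Proof. by rewrite R_gen ?inE ?eqxx. Qed.
Lemma R_x : x \in R. Proof. by rewrite R_gen ?inE ?eqxx ?orbT. Qed.
Lemma R_u : u \in R. Proof. by rewrite R_gen ?inE ?eqxx ?orbT. Qed.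
Lemma R_1 : 1 \in R. Proof. by apply: (subvP (sub1_agenv _)); exact: memv_line. Qed.

Lemma R_ind (P : D -> Prop) : linear_pred P -> P 1 ->
  (forall a, a \in R -> P a -> P (g * a)) ->
  (forall a, a \in R -> P a -> P (x * a)) ->
  (forall a, a \in R -> P a -> P (u * a)) -> forall a, a \in R -> P a.
Proof.
move=> [P0 PD PZ] P1 Pg Px Pu a aR.
suff [] : a \in R /\ P a by [].
move: a aR; apply: agenv_ind; first split=> [|a b [aR Pa] [bR Pb]|c a [aR Pa]].
- by rewrite mem0v.
- by rewrite memvD //; auto.
- by rewrite memvZ //; auto.
- by rewrite R_1.
move=> s a sX [aR Pa]; split; first exact: memvM (R_gen sX) aR.
by move: sX; rewrite !inE => /or3P[] /eqP->; auto.
Qed.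

Lemma R_commute a b : a \in R -> b \in R -> a * b = b * a.
Proof.
have lin s : linear_pred (fun b => s * b = b * s).
  split=> [|c d cs ds|z c cs]; first by rewrite mulr0 mul0r.
    by rewrite mulrDr mulrDl cs ds.
  by rewrite -scalerAr -scalerAl cs.
have gen s : s * g = g * s -> s * x = x * s -> s * u = u * s ->
    forall c, c \in R -> s * c = c * s.
  move=> sg sx su; apply: R_ind => [//||d _ e|d _ e|d _ e].
  - by rewrite mulr1 mul1r.
  - by rewrite mulrA sg -!mulrA e.
  - by rewrite mulrA sx -!mulrA e.
  - by rewrite mulrA su -!mulrA e.
have gC := gen g erefl (rel_gx rels) (esym (rel_ug rels)).
have xC := gen x (esym (rel_gx rels)) erefl (esym (rel_ux rels)).
have uC := gen u (rel_ug rels) (rel_ux rels) erefl.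
by move=> aR; apply: gen; apply: esym; [exact: gC | exact: xC | exact: uC].
Qed.

(** Commutation with t is a derivation, so it is enough to control it on
    generators. *)
Lemma R_commutator t : t * g - g * t \in R -> t * x - x * t \in R ->
  t * u - u * t \in R -> forall r, r \in R -> t * r - r * t \in R.
Proof.
have step s a : s \in R -> a \in R -> t * s - s * t \in R -> t * a - a * t \in R ->
    t * (s * a) - s * a * t \in R.
  move=> sR aR ts ta.
  have -> : t * (s * a) - s * a * t = (t * s - s * t) * a + s * (t * a - a * t).
    by rewrite mulrBl mulrBr !mulrA addrA subrK.
  by rewrite memvD ?memvM.
move=> tg tx tu; apply: R_ind => [|||| ].
- split=> [|a b aR bR|c a aR].
  + by rewrite mulr0 mul0r subrr mem0v.
  + by rewrite mulrDr mulrDl opprD addrACA memvD.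
  + by rewrite -scalerAl -scalerAr -scalerBr memvZ.
- by rewrite mulr1 mul1r subrr mem0v.
- by move=> a aR; apply: step => //; exact: R_g.
- by move=> a aR; apply: step => //; exact: R_x.
- by move=> a aR; apply: step => //; exact: R_u.
Qed.

Lemma R_commutator_y r : r \in R -> y * r - r * y \in R.
Proof.
apply: R_commutator.
- by rewrite (rel_gy rels) opprD addrA subrr sub0r memvN memvM ?R_g ?R_x.
- by rewrite (rel_yx rels) addrAC subrr sub0r memvN memvZ // expr2 memvM ?R_x.
- by rewrite (rel_uy rels) opprD addrA subrr sub0r memvN memvB ?R_1 ?R_g.
Qed.

Lemma R_commutator_zeta r : r \in R -> zeta * r - r * zeta \in R.
Proof.
apply: R_commutator.
- by rewrite (rel_gzeta rels) subrr mem0v.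
- by rewrite (rel_zetax rels) addrAC subrr add0r R_x.
- by rewrite (rel_uzeta rels) opprD addrA subrr sub0r memvN R_u.
Qed.

Lemma R_commutator_v r : r \in R -> v * r - r * v \in R.
Proof.
apply: R_commutator.
- by rewrite (rel_vg rels) addrAC subrr add0r memvM ?R_g ?R_u.
- rewrite (rel_vx rels) addrC !addrA addNr add0r.
  by rewrite memvD ?memvB ?memvM ?R_g ?R_x ?R_u ?R_1.
- by rewrite (rel_vu rels) addrAC subrr sub0r memvN memvZ // expr2 memvM ?R_u.
Qed.

Lemma double_g_neq0 : g != 0.
Proof. by apply: contraTneq (double_g_unit p_gt2 D_double) => ->; rewrite unitr0. Qed.

Lemma counit_gxu : [/\ ε g = 1, ε x = 0 & ε u = 0].
Proof.
split.
- exact: (counit_grouplike double_g_neq0 (double_comul_g D_double)).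
- exact: (counit_skew_primitive double_g_neq0 (double_comul_x D_double)).
- exact: (counit_skew_primitive (oner_neq0 _) (double_comul_u D_double)).
Qed.

Lemma antipode_g : S g = g ^+ p.-1.
Proof.
have [Sgg _] := antipode_grouplike double_g_neq0 (double_comul_g D_double).
have p_gt0 : (0 < p)%N by apply: leq_trans p_gt2.
by rewrite -[LHS]mulr1 -(rel_gp rels) -{1}(prednK p_gt0) exprS mulrA Sgg mul1r.
Qed.

Lemma R_exp a n : a \in R -> a ^+ n \in R.
Proof.
by move=> aR; elim: n => [|n IHn]; [exact: R_1 | rewrite exprS memvM].
Qed.

Lemma R_antipode_g : S g \in R.
Proof. by rewrite antipode_g R_exp ?R_g. Qed.

(** The coproduct is multiplicative and the antipode antimultiplicative, so that
    both statements reduce to g, x and u. *)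
Lemma R_hopf : is_hopf_subalgebra hD R.
Proof.
split; first exact: R_1.
  apply: R_ind => [||||].
  - split=> [|a b aR bR|c a aR]; first by rewrite linear0 mem0v.
      by rewrite linearD memvD.
    by rewrite linearZ memvZ.
  - by rewrite rmorph1 mem_tensorv ?R_1.
  - by move=> a aR Ra; rewrite rmorphM /= (double_comul_g D_double) tensorvM ?mem_tensorv ?R_g.
  - move=> a aR Ra; rewrite rmorphM /= (double_comul_x D_double) tensorvM //.
    by rewrite memvD ?mem_tensorv ?R_g ?R_x ?R_1.
  - move=> a aR Ra; rewrite rmorphM /= (double_comul_u D_double) tensorvM //.
    by rewrite memvD ?mem_tensorv ?R_u ?R_1.
apply: R_ind => [||||].
- split=> [|a b aR bR|c a aR]; first by rewrite linear0 mem0v.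
    by rewrite linearD memvD.
  by rewrite linearZ memvZ.
- by rewrite antipode1 R_1.
- by move=> a aR Ra; rewrite antipodeM memvM ?R_antipode_g.
- move=> a aR Ra; rewrite antipodeM memvM //.
  rewrite (antipode_skew_primitive double_g_neq0 (double_comul_x D_double)).
  by rewrite memvN memvM ?R_antipode_g ?R_x.
- move=> a aR Ra; rewrite antipodeM memvM //.
  rewrite (antipode_skew_primitive (oner_neq0 _) (double_comul_u D_double)).
  by rewrite memvN antipode1 mul1r R_u.
Qed.
End SubalgebraR.

(** * Normality of the subalgebra R *)

Section SubalgebraRProperties.
Variables (k : fieldType) (p : nat).
Hypotheses (p_char : p \in [pchar k]) (p_gt2 : (2 < p)%N).
Variables (D : falgType k) (hD : hopf_structure D) (u v zeta g x y : D).
Hypothesis D_double : is_drinfeld_double p hD u v zeta g x y.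
Local Notation Δ := (comul hD).
Local Notation ε := (counit hD).
Local Notation S := (antipode hD).
Local Notation R := (double_R u g x).
Let rels := double_rel D_double.

Lemma double_ind (P : D -> Prop) : linear_pred P -> P 1 ->
  (forall s a, s \in [:: u; v; zeta; g; x; y] -> P a -> P (s * a)) -> forall a, P a.
Proof.
move=> Plin P1 PM a; apply: (agenv_ind Plin P1 PM).
by rewrite (double_gen D_double) memvf.
Qed.

Let Sg : S g * g = 1 /\ g * S g = 1.
Proof. exact: antipode_grouplike (double_g_neq0 p_gt2 D_double) (double_comul_g D_double). Qed.

Let SgR : S g \in R.
Proof. exact: (R_antipode_g p_gt2 D_double). Qed.

Lemma counit_vzy : [/\ ε v = 0, ε zeta = 0 & ε y = 0].
Proof.
have εu : ε u = 0 by have [] := counit_gxu p_gt2 D_double.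
split.
- have := counitr hD v; rewrite (double_comul_v D_double) 2!linearD /=.
  rewrite !tliftE; try exact: (bilinear_scaler ε idfun).
  rewrite rmorph1 scale1r εu scale0r addr0 => /(canRL (addKr _))/eqP.
  by rewrite addNr scaler_eq0 oner_eq0 orbF => /eqP.
- exact: (counit_skew_primitive (oner_neq0 _) (double_comul_zeta D_double)).
- exact: (counit_skew_primitive (double_g_neq0 p_gt2 D_double) (double_comul_y D_double)).
Qed.

Lemma antipode_v : S v = zeta * u - v.
Proof.
have [εv _ _] := counit_vzy.
have := antipodel hD v; rewrite (double_comul_v D_double) 2!linearD /= εv scale0r.
rewrite !tliftE; try exact: (bilinear_mul S idfun).
rewrite (antipode_skew_primitive (oner_neq0 _) (double_comul_zeta D_double)).
rewrite antipode1 !mul1r mulr1 mulNr => /eqP.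
by rewrite -addrA addr_eq0 => /eqP->; rewrite opprD opprK addrC.
Qed.

Lemma adl_v r : adl hD v r = (v * r - r * v) - (zeta * r - r * zeta) * u.
Proof.
rewrite /adl (double_comul_v D_double) 2!linearD /= !tliftE;
  try exact: (bilinear_mul (r \o* idfun) S).
rewrite /= antipode1 mulr1 mul1r antipode_v.
rewrite (antipode_skew_primitive (oner_neq0 _) (double_comul_u D_double)) antipode1 mul1r.
rewrite mulrBr mulrN mulrBl -!mulrA !opprB -!addrA; congr (_ + _).
by rewrite addrCA.
Qed.

Lemma adr_v r : r * u = u * r -> adr hD v r = r * v - v * r.
Proof.
move=> ru; rewrite /adr (double_comul_v D_double) 2!linearD /= !tliftE;
  try exact: (bilinear_mul (r \o* S) idfun).
rewrite /= antipode1 mulr1 mul1r antipode_v.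
rewrite (antipode_skew_primitive (oner_neq0 _) (double_comul_zeta D_double)) antipode1 mul1r.
rewrite mulrBl mulNr mulNr -!mulrA ru addrAC [X in X + _]addrAC subrr add0r addrC //.
Qed.

(** The element g acts by conjugation inside R. The other generators act by
    commutators, up to the factor g^-1 and, for v, a multiple of a commutator with zeta;
    each of these commutators stabilizes R. *)
Lemma R_adl_gen s r : s \in [:: u; v; zeta; g; x; y] -> r \in R ->
  adl hD s r \in R /\ adr hD s r \in R.
Proof.
have g0 := double_g_neq0 p_gt2 D_double; have [Sgg gSg] := Sg.
have Ru := R_u u g x; have Rg := R_g u g x; have Rx := R_x u g x.
have prim a b : Δ a = a ⊗ 1 + 1 ⊗ a -> a * b - b * a \in R ->
    adl hD a b \in R /\ adr hD a b \in R.
  move=> Δa ar; have Δ1 : Δ 1 = 1 ⊗ 1 by exact: rmorph1.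
  rewrite (adl_skew_primitive (oner_neq0 _) Δ1 Δa) ?mul1r ?mulr1 //.
  rewrite (adr_skew_primitive _ (oner_neq0 _) Δa) antipode1 mul1r; split=> //.
  by rewrite -opprB memvN.
have skew a b : Δ a = a ⊗ 1 + g ⊗ a -> b \in R -> a * b - b * a \in R ->
    adl hD a b \in R /\ adr hD a b \in R.
  move=> Δa bR ab; rewrite (adl_skew_primitive g0 (double_comul_g D_double) Δa).
    rewrite (adr_skew_primitive _ g0 Δa); split=> //.
    by rewrite memvM ?SgR // -opprB memvN.
  exact: (R_commute D_double).
move=> + rR; rewrite !inE => /or4P[/eqP-> | /eqP-> | /eqP-> | /or3P[] /eqP->].
- apply: prim; first exact: double_comul_u D_double.
  by rewrite (R_commute D_double Ru rR) subrr mem0v.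
- rewrite adl_v adr_v; last exact: (R_commute D_double).
  have vr := R_commutator_v D_double rR; split.
    by rewrite memvB // memvM // (R_commutator_zeta D_double).
  by rewrite -opprB memvN.
- apply: prim; first exact: double_comul_zeta D_double.
  exact: (R_commutator_zeta D_double rR).
- rewrite (adl_grouplike _ (double_comul_g D_double)).
  rewrite (adr_grouplike _ (double_comul_g D_double)).
  by split; rewrite !memvM ?SgR.
- apply: skew; [exact: double_comul_x D_double | by [] |].
  by rewrite (R_commute D_double Rx rR) subrr mem0v.
- apply: skew; [exact: double_comul_y D_double | by [] |].
  exact: (R_commutator_y D_double rR).
Qed.

(** The adjoint actions are actions of the algebra D, so generators of D suffice. *)
Lemma R_normal : is_normal hD R.
Proof.
apply: (double_ind (P := fun c => forall r, r \in R ->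
  adl hD c r \in R /\ adr hD c r \in R)) => [||s a sX IHa r rR].
- split=> [r _ | a b IHa IHb r rR | z a IHa r rR].
  + by rewrite /adl /adr !linear0 mem0v.
  + have [al ar] := IHa r rR; have [bl br] := IHb r rR.
    by rewrite /adl /adr !linearD !memvD.
  + have [al ar] := IHa r rR.
    by rewrite /adl /adr !linearZ !memvZ.
- move=> r rR; have Δ1 : Δ 1 = 1 ⊗ 1 by exact: rmorph1.
  by rewrite (adl_grouplike _ Δ1) (adr_grouplike _ Δ1) antipode1 !mul1r !mulr1.
have [lR _] := IHa r rR; have [_ rR'] := R_adl_gen sX rR.
rewrite adlM adrM; split; first by have [] := R_adl_gen sX lR.
by have [] := IHa _ rR'.
Qed.
End SubalgebraRProperties.

(** * Basis, Frobenius and presentation of the subalgebra R *)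

Section MonomialMap.
Variables (k : fieldType) (p : nat).
Hypothesis p_gt0 : (0 < p)%N.
Local Notation I := ('I_p * 'I_p * 'I_p)%type.

Definition monomial (T : algType k) (g x u : T) (a b d : nat) : T :=
  g ^+ a * (x ^+ b * u ^+ d).

Definition monomial_map (T : algType k) (g x u : T) (c : {ffun I -> k^o}) : T :=
  \sum_α (c α : k) *: monomial g x u α.1.1 α.1.2 α.2.

Fact monomial_map_is_linear (T : algType k) (g x u : T) : linear (monomial_map g x u).
Proof.
move=> z c d; rewrite /monomial_map scaler_sumr -big_split; apply: eq_bigr => α _ /=.
by rewrite !ffunE scalerDl scalerA.
Qed.
HB.instance Definition _ (T : algType k) (g x u : T) :=
  GRing.isLinear.Build k {ffun I -> k^o} T *:%R (monomial_map g x u)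
    (monomial_map_is_linear g x u).

Definition unit_coeff (α : I) : {ffun I -> k^o} := [ffun β => (β == α)%:R].

Lemma monomial_map_unit (T : algType k) (g x u : T) α :
  monomial_map g x u (unit_coeff α) = monomial g x u α.1.1 α.1.2 α.2.
Proof.
rewrite /monomial_map (bigD1 α) //= ffunE eqxx scale1r big1 ?addr0 // => β neq_βα.
by rewrite ffunE (negPf neq_βα) scale0r.
Qed.

(** The coefficients depend on the exponents only: they are found by reducing the
    exponent of g modulo p and by killing p-th powers of x and u. The same vector can
    therefore be used in R and in any target of a morphism from R. *)
Lemma monomial_coeff a b d : exists c : {ffun I -> k^o},
  forall (T : algType k) (g x u : T), truncated_relations p g x u ->
  monomial g x u a b d = monomial_map g x u c.
Proof.
have [ltb | leb] := ltnP b p; last first.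
  exists 0 => T g x u [_ xp _]; rewrite linear0 /monomial -(subnK leb) exprD xp.
  by rewrite mulr0 mul0r mulr0.
have [ltd | led] := ltnP d p; last first.
  exists 0 => T g x u [_ _ up]; rewrite linear0 /monomial -(subnK led) exprD up.
  by rewrite !mulr0.
exists (unit_coeff (Ordinal (ltn_pmod a p_gt0), Ordinal ltb, Ordinal ltd)) => T g x u [gp _ _].
rewrite monomial_map_unit /monomial /= {1}(divn_eq a p) exprD mulnC exprM gp.
by rewrite expr1n mul1r.
Qed.
End MonomialMap.

Section RBasis.
Variables (k : fieldType) (p : nat).
Hypotheses (p_char : p \in [pchar k]) (p_gt2 : (2 < p)%N).
Variables (D : falgType k) (hD : hopf_structure D) (u v zeta g x y : D).
Hypothesis D_double : is_drinfeld_double p hD u v zeta g x y.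
Local Notation ε := (counit hD).
Local Notation R := (double_R u g x).
Local Notation I := ('I_p * 'I_p * 'I_p)%type.
Let rels := double_rel D_double.

Let p_gt0 : (0 < p)%N. Proof. by apply: leq_trans p_gt2. Qed.

Let R_rel : truncated_relations p g x u.
Proof. by split; [exact: rel_gp rels | exact: rel_xp rels | exact: rel_up rels]. Qed.

Lemma R_monomial_mul_g a b d : g * monomial g x u a b d = monomial g x u a.+1 b d.
Proof. by rewrite /monomial exprS -mulrA. Qed.

Lemma R_monomial_mul_x a b d : x * monomial g x u a b d = monomial g x u a b.+1 d.
Proof.
have xg : GRing.comm x (g ^+ a) by apply/commrX/esym/(rel_gx rels).
by rewrite /monomial exprS !mulrA xg.
Qed.

Lemma R_monomial_mul_u a b d : u * monomial g x u a b d = monomial g x u a b d.+1.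
Proof.
have ugx : GRing.comm u (g ^+ a * x ^+ b).
  by apply: commrM; apply: commrX; [exact: rel_ug rels | exact: rel_ux rels].
by rewrite /monomial exprS !mulrA -(mulrA u) ugx.
Qed.

Lemma R_monomial a b d : monomial g x u a b d \in R.
Proof. by rewrite !memvM ?R_exp ?R_g ?R_x ?R_u. Qed.

Definition R_coeffs : 'Hom({ffun I -> k^o}, D) := linfun (monomial_map g x u).

Lemma R_coeffs_inj : lker R_coeffs == 0%VS.
Proof.
rewrite -subv0; apply/subvP=> c; rewrite memv_ker lfunE memv0 => /eqP c0.
apply/eqP/ffunP=> α; rewrite ffunE.
exact: (R_monomials_free p_char p_gt2 D_double (c := c)).
Qed.

Lemma R_limg : limg R_coeffs = R.
Proof.
have monoP a b d : monomial g x u a b d \in limg R_coeffs.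
  have [c cE] := monomial_coeff k p_gt0 a b d.
  by rewrite (cE _ _ _ _ R_rel) -[monomial_map _ _ _ _](lfunE (monomial_map g x u)) memv_img ?memvf.
apply/eqP; rewrite eqEsubv; apply/andP; split; apply/subvP.
  move=> _ /memv_imgP[c _ ->]; rewrite lfunE memv_suml // => α _.
  by rewrite memvZ ?R_monomial.
have stable s :
    (forall a b d, exists a' b' d',
      s * monomial g x u a b d = monomial g x u a' b' d') ->
    forall r, r \in limg R_coeffs -> s * r \in limg R_coeffs.
  move=> sM _ /memv_imgP[c _ ->]; rewrite lfunE /= mulr_sumr memv_suml // => α _.
  have [a' [b' [d' sE]]] := sM α.1.1 α.1.2 α.2.
  by rewrite -scalerAr memvZ // sE.
apply: R_ind => [|| r _ | r _ | r _].
- split=> [|a b aR bR|c a aR]; first by rewrite mem0v.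
    by rewrite memvD.
  by rewrite memvZ.
- by have := monoP 0 0 0; rewrite /monomial !mulr1.
- by apply: stable => a b d; exists a.+1, b, d; exact: R_monomial_mul_g.
- by apply: stable => a b d; exists a, b.+1, d; exact: R_monomial_mul_x.
- by apply: stable => a b d; exists a, b, d.+1; exact: R_monomial_mul_u.
Qed.

Lemma R_dim : \dim R = (p ^ 3)%N.
Proof.
rewrite -R_limg limg_dim_eq ?capvf; last first.
  by move: R_coeffs_inj => /eqP->; rewrite capv0.
by rewrite dimvf [LHS]muln1 !card_prod !card_ord !expnS expn0 muln1 mulnA.
Qed.

(** The Frobenius map is additive on the commutative algebra R and sends g, x and u
    to 1, 0 and 0, the p-th powers of their counits. *)
Lemma R_pow r : r \in R -> r ^+ p = ((ε r : k) ^+ p)%:A.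
Proof.
have [εg εx εu] := counit_gxu p_gt2 D_double.
have p_charD : p \in [pchar D] by rewrite pchar_lalg.
have frobD (a b : k) : (a + b) ^+ p = a ^+ p + b ^+ p.
  by rewrite -!(pFrobenius_autE p_char) rmorphD.
pose P r := r \in R /\ r ^+ p = ((ε r : k) ^+ p)%:A.
suff RP : forall r, r \in R -> P r by move=> /RP[].
have PM s a : s \in R -> s ^+ p = ((ε s : k) ^+ p)%:A -> a \in R -> P a -> P (s * a).
  move=> sR sp aR [_ ap]; split; first exact: memvM.
  rewrite exprMn_comm; last exact: (R_commute D_double).
  by rewrite sp ap -scalerAl mul1r scalerA rmorphM /= exprMn.
have pS : (p == 0)%N = false by exact: gtn_eqF p_gt0.
apply: R_ind => [|| a aR Pa | a aR Pa | a aR Pa].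
- split=> [|a b [aR ap] [bR bp]|c a [aR ap]].
  + by split; rewrite ?mem0v // linear0 !expr0n pS scale0r.
  + split; rewrite ?memvD // linearD frobD scalerDl -ap -bp.
    have ab : GRing.comm a b by exact: (R_commute D_double).
    by rewrite -!(pFrobenius_autE p_charD) pFrobenius_autD_comm.
  + by split; rewrite ?memvZ // linearZ exprZn ap scalerA exprMn.
- by split; rewrite ?R_1 // rmorph1 !expr1n scale1r.
- by apply: PM; rewrite ?R_g // (rel_gp rels) εg expr1n scale1r.
- by apply: PM; rewrite ?R_x // (rel_xp rels) εx expr0n pS scale0r.
- by apply: PM; rewrite ?R_u // (rel_up rels) εu expr0n pS scale0r.
Qed.

Lemma R_algid : algid R = 1.
Proof. by apply/eqP; rewrite algid_eq1 R_1. Qed.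

(** An element of R with nonzero counit is invertible, because its p-th power is a
    nonzero scalar. Hence the kernel of the counit contains every proper ideal. *)
Lemma R_local : is_local (subvs_of R).
Proof.
have R1 : vsval (1 : subvs_of R) = 1 by exact: R_algid.
pose ε' : 'Hom(subvs_of R, k^o) := (ε \o linfun (vsval : subvs_of R -> D))%VF.
have ε'E r : ε' r = ε (vsval r) by rewrite comp_lfunE lfunE.
have ε'1 : ε' 1 = 1 by rewrite ε'E R1 rmorph1.
pose M := lker ε'.
have full1 (J : {vspace subvs_of R}) : is_left_ideal J -> 1 \in J -> J = fullv.
  move=> Jideal J1; apply/eqP; rewrite eqEsubv subvf /=; apply/subvP=> r _.
  by rewrite -[r]mulr1; apply: (subvP Jideal); rewrite memv_mul ?memvf.
have proper_sub (J : {vspace subvs_of R}) : is_left_ideal J -> J != fullv -> (J <= M)%VS.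
  move=> Jideal Jproper; apply/subvP=> r rJ; rewrite memv_ker ε'E.
  apply: contraNT Jproper => εr; apply/eqP/full1 => //.
  have -> : 1 = ((ε (vsval r) : k) ^+ p)^-1 *: (r ^+ p.-1 * r) :> subvs_of R.
    rewrite -exprSr (prednK p_gt0); apply: subvs_inj.
    have valX := rmorphXn (subalg_incl (R_hopf p_gt2 D_double)) p r.
    rewrite R1 linearZ /= [X in _ *: X]valX /= (R_pow (subvsP r)) scalerA mulVf ?scale1r //.
    by rewrite expf_neq0.
  by rewrite memvZ //; apply: (subvP Jideal); rewrite memv_mul ?memvf.
have Mideal : is_left_ideal M.
  apply/prodvP=> a b _; rewrite !memv_ker !ε'E => /eqP b0.
  by rewrite rmorphM /= b0 mulr0.
have Mproper : M != fullv.
  apply: contraTneq (memvf (1 : subvs_of R)) => <-.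
  by rewrite memv_ker ε'1 oner_eq0.
exists M; split.
  split=> // J Jideal MJ; have [-> | Jproper] := eqVneq J fullv; first by right.
  by left; apply/eqP; rewrite eqEsubv MJ proper_sub.
move=> J [Jideal Jproper Jmax].
have [// | M_full] := Jmax M Mideal (proper_sub J Jideal Jproper).
by rewrite M_full eqxx in Mproper.
Qed.

Lemma R_vsprojM a b : a \in R -> b \in R ->
  vsproj R (a * b) = vsproj R a * vsproj R b.
Proof.
by move=> aR bR; apply: subvs_inj; rewrite /= !vsprojK ?memvM.
Qed.

Lemma R_vsproj1 : vsproj R 1 = 1.
Proof. by apply: subvs_inj; rewrite /= vsprojK ?R_1 // R_algid. Qed.

Lemma R_vsprojX a n : a \in R -> vsproj R (a ^+ n) = vsproj R a ^+ n.
Proof.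
move=> aR; elim: n => [|n IHn]; first exact: R_vsproj1.
by rewrite !exprS R_vsprojM ?R_exp // IHn.
Qed.

(** The map to B is defined linearly on the basis of monomials; it is
    multiplicative because it is compatible with multiplication by g, x and u. *)
Lemma R_presentation :
  truncated_presentation p (vsproj R g) (vsproj R x) (vsproj R u).
Proof.
split.
- by move=> a b; apply: subvs_inj; apply: (R_commute D_double); exact: subvsP.
- apply/eqP; rewrite eqEsubv subvf; apply/subvP=> r _.
  set X := [:: _; _; _].
  suff RX : forall a, a \in R -> vsproj R a \in agenv <<X>>.
    by rewrite -[r]vsvalK RX ?subvsP.
  have memX s : s \in X -> s \in agenv <<X>>.
    by move=> sX; apply: (subvP (sub_agenv _)); exact: memv_span.
  have mulX a b : a \in agenv <<X>> -> b \in agenv <<X>> -> a * b \in agenv <<X>>.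
    by move=> aX bX; apply: (@memvM _ _ (agenv_aspace <<X>>)).
  apply: R_ind => [|| a aR IHa | a aR IHa | a aR IHa].
  + split=> [|a b aX bX|c a aX]; first by rewrite linear0 mem0v.
      by rewrite linearD memvD.
    by rewrite linearZ memvZ.
  + by rewrite R_vsproj1; apply: (subvP (sub1_agenv _)); exact: memv_line.
  + by rewrite R_vsprojM ?R_g //; apply: mulX => //; apply: memX; rewrite !inE eqxx ?orbT.
  + by rewrite R_vsprojM ?R_x //; apply: mulX => //; apply: memX; rewrite !inE eqxx ?orbT.
  + by rewrite R_vsprojM ?R_u //; apply: mulX => //; apply: memX; rewrite !inE eqxx ?orbT.
- have [gp xp up] := R_rel.
  split; rewrite -R_vsprojX ?R_g ?R_x ?R_u // ?gp ?xp ?up ?linear0 //.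
  exact: R_vsproj1.
move=> B g' x' u' B_rel.
pose ψ : {linear D -> B} := monomial_map g' x' u' \o (R_coeffs^-1)%VF.
have ψmono a b d : ψ (monomial g x u a b d) = monomial g' x' u' a b d.
  have [c cE] := monomial_coeff k p_gt0 a b d.
  rewrite (cE _ _ _ _ R_rel) (cE _ _ _ _ B_rel) /= -(lfunE (monomial_map g x u)).
  by rewrite (lker0_lfunK R_coeffs_inj).
have ψD a b : ψ (a + b) = ψ a + ψ b by exact: linearD.
have ψZ z a : ψ (z *: a) = z *: ψ a by exact: linearZ.
have ψR r : r \in R -> forall P : D -> Prop, linear_pred P ->
    (forall a b d, P (monomial g x u a b d)) -> P r.
  rewrite -R_limg => /memv_imgP[c _ ->] P Plin Pm; rewrite lfunE /= /monomial_map.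
  by apply: linear_pred_sum => // α; have [_ _ PZ] := Plin; exact: PZ (Pm _ _ _).
have ψM s t : (forall a b d, ψ (s * monomial g x u a b d) = t * ψ (monomial g x u a b d)) ->
    forall r, r \in R -> ψ (s * r) = t * ψ r.
  move=> sM r rR; apply: (ψR r rR (fun r => ψ (s * r) = t * ψ r)) => //.
  split=> [|a b ea eb|c a ea].
  + by rewrite mulr0 linear0 mulr0.
  + by rewrite mulrDr !ψD mulrDr ea eb.
  + by rewrite -scalerAr !ψZ ea scalerAr.
have ψg : forall r, r \in R -> ψ (g * r) = g' * ψ r.
  by apply: ψM => a b d; rewrite R_monomial_mul_g !ψmono /monomial exprS -mulrA.
have ψx : forall r, r \in R -> ψ (x * r) = x' * ψ r.
  apply: ψM => a b d; rewrite R_monomial_mul_x !ψmono /monomial exprS.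
  by rewrite -mulrA mulrCA.
have ψu : forall r, r \in R -> ψ (u * r) = u' * ψ r.
  apply: ψM => a b d; rewrite R_monomial_mul_u !ψmono /monomial exprS.
  by rewrite [RHS]mulrCA; congr (_ * _); rewrite [RHS]mulrCA.
have ψ1 : ψ 1 = 1.
  by have := ψmono 0 0 0; rewrite /monomial !mulr1.
have ψmul : forall a, a \in R -> forall b, b \in R -> ψ (a * b) = ψ a * ψ b.
  apply: R_ind => [| b _ | a aR IHa b bR | a aR IHa b bR | a aR IHa b bR].
  - split=> [b _|a b IHa IHb c cR|z a IHa b bR].
    + by rewrite mul0r linear0 mul0r.
    + by rewrite mulrDl !ψD mulrDl IHa ?IHb.
    + by rewrite -scalerAl !ψZ IHa // scalerAl.
  - by rewrite ψ1 !mul1r.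
  - by rewrite -mulrA !ψg ?memvM // IHa // mulrA.
  - by rewrite -mulrA !ψx ?memvM // IHa // mulrA.
  - by rewrite -mulrA !ψu ?memvM // IHa // mulrA.
pose φ (r : subvs_of R) : B := ψ (vsval r).
have φlin : linear φ by move=> z a b; rewrite /φ !linearP.
have φmul : monoid_morphism φ.
  split=> [|a b]; first by rewrite /φ -[vsval 1]/(algid R) R_algid.
  exact: ψmul (subvsP a) _ (subvsP b).
pose φL : {lrmorphism subvs_of R -> B} :=
  HB.pack φ (GRing.isLinear.Build k (subvs_of R) B *:%R φ φlin)
    (GRing.isMonoidMorphism.Build _ _ φ φmul).
have φLE a : a \in R -> φL (vsproj R a) = ψ a by move=> aR; exact: (congr1 ψ (vsprojK aR)).
exists φL; split; rewrite φLE ?R_g ?R_x ?R_u //.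
- by have := ψmono 1 0 0; rewrite /monomial !mulr1 !expr1.
- by have := ψmono 0 1 0; rewrite /monomial !mulr1 !mul1r !expr1.
- by have := ψmono 0 0 1; rewrite /monomial !mul1r !expr1.
Qed.
End RBasis.

(** * Spanning of the double over R *)

Section DoubleSpanning.
Variables (k : fieldType) (p : nat).
Hypotheses (p_char : p \in [pchar k]) (p_gt2 : (2 < p)%N).
Variables (D : falgType k) (hD : hopf_structure D) (u v zeta g x y : D).
Hypothesis D_double : is_drinfeld_double p hD u v zeta g x y.
Local Notation R := (double_R u g x).
Local Notation I := ('I_p * 'I_p * 'I_p)%type.
Let rels := double_rel D_double.

Let p_gt0 : (0 < p)%N. Proof. by apply: leq_trans p_gt2. Qed.

Let inR (a : D) : Prop := a \in R.
Let Q1 := power_span v p inR.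
Let Q2 := power_span zeta p Q1.
Let Q3 := power_span y p Q2.

Let R_subalg : subalgebra_pred inR.
Proof.
split; first split=> [|a b aR bR|c a aR]; rewrite /inR ?mem0v ?R_1 //.
- exact: memvD.
- exact: memvZ.
- by move=> a b aR bR; exact: memvM.
Qed.

Let R_commutes t (P : D -> Prop) : (forall a, a \in R -> P a) ->
  (forall r, r \in R -> t * r - r * t \in R) ->
  forall a, a \in R -> commutes_mod t P a.
Proof.
move=> RP tR a aR; exists a, (a * t - t * a); split; auto; last by rewrite addrC subrK.
by apply: RP; rewrite -opprB memvN tR.
Qed.

Let v_pow : Q1 (v ^+ p).
Proof. by rewrite (rel_vp rels); have [] := power_span_linear v p R_subalg. Qed.

Let v_comm a : inR a -> commutes_mod v inR a.
Proof. by apply: R_commutes => // r; exact: (R_commutator_v D_double). Qed.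

Let Q1_subalg : subalgebra_pred Q1.
Proof. exact: power_span_subalgebra R_subalg p_gt0 v_pow v_comm. Qed.

Let R_Q1 a : a \in R -> Q1 a.
Proof. exact: power_span_incl R_subalg p_gt0 _. Qed.

Let v_Q1 : Q1 v.
Proof. exact: power_span_gen R_subalg p_gt0 v_pow. Qed.

Let zeta_pow : Q2 (zeta ^+ p).
Proof.
have [_ Q1_1 _] := Q1_subalg.
rewrite (rel_zetap rels) -[zeta]mulr1 -[X in X * _]expr1.
by apply: (power_span_term zeta Q1_subalg) => //; apply: leq_trans p_gt2.
Qed.

Let zeta_comm a : Q1 a -> commutes_mod zeta Q1 a.
Proof.
move: a; apply: (power_span_ind R_subalg p_gt0 v_pow).
- exact: commutes_mod_linear.
- by move=> a b aQ1; apply: commutes_mod_mul.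
- exact: commutes_mod1.
- by exists v, v; split => //; rewrite (rel_vzeta rels).
- by apply: R_commutes => // r; exact: (R_commutator_zeta D_double).
Qed.

Let Q2_subalg : subalgebra_pred Q2.
Proof. exact: power_span_subalgebra Q1_subalg p_gt0 zeta_pow zeta_comm. Qed.

Let Q1_Q2 a : Q1 a -> Q2 a.
Proof. exact: power_span_incl Q1_subalg p_gt0 _. Qed.

Let zeta_Q2 : Q2 zeta.
Proof. exact: power_span_gen Q1_subalg p_gt0 zeta_pow. Qed.

Let y_pow : Q3 (y ^+ p).
Proof. by rewrite (rel_yp rels); have [] := power_span_linear y p Q2_subalg. Qed.

Let y_comm a : Q2 a -> commutes_mod y Q2 a.
Proof.
have [[Q2_0 Q2D Q2Z] Q2_1 Q2M] := Q2_subalg.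
move: a; apply: (power_span_ind Q1_subalg p_gt0 zeta_pow).
- exact: commutes_mod_linear.
- by move=> a b aQ2; apply: commutes_mod_mul.
- exact: commutes_mod1.
- exists (zeta + 1), 0; split; [exact: Q2D | by [] |].
  by rewrite (rel_zetay rels) mulrDr mulr1 addr0.
apply: (power_span_ind R_subalg p_gt0 v_pow).
- exact: commutes_mod_linear.
- by move=> a b /Q1_Q2 aQ2; apply: commutes_mod_mul.
- exact: commutes_mod1.
- exists (v + u), (- (g * zeta)); split.
  + by apply: Q2D; apply: Q1_Q2; [exact: v_Q1 | apply: R_Q1; exact: R_u].
  + rewrite -scaleN1r; apply/Q2Z/Q2M; last exact: zeta_Q2.
    by apply/Q1_Q2/R_Q1; exact: R_g.
  + by rewrite (rel_vy rels) mulrDr addrAC.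
- apply: R_commutes => [a aR | r]; first exact/Q1_Q2/R_Q1.
  exact: (R_commutator_y D_double).
Qed.

Let Q3_subalg : subalgebra_pred Q3.
Proof. exact: power_span_subalgebra Q2_subalg p_gt0 y_pow y_comm. Qed.

Let Q2_Q3 a : Q2 a -> Q3 a.
Proof. exact: power_span_incl Q2_subalg p_gt0 _. Qed.

(** The variables v, zeta and y are adjoined to R in this order; each commutes
    with the subalgebra already obtained up to terms of lower degree, by the relations
    of D. *)
Lemma double_span (d : D) : exists2 r : I -> D, forall α, r α \in R &
  d = \sum_(α : I) y ^+ α.1.1 * zeta ^+ α.1.2 * v ^+ α.2 * r α.
Proof.
have [Q3lin Q3_1 Q3M] := Q3_subalg.
have : Q3 d.
  apply: (double_ind D_double) => // s a sX; apply: Q3M; move: sX.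
  rewrite !inE => /or4P[/eqP-> | /eqP-> | /eqP-> | /or3P[] /eqP->].
  - by apply/Q2_Q3/Q1_Q2/R_Q1; exact: R_u.
  - exact/Q2_Q3/Q1_Q2/v_Q1.
  - exact/Q2_Q3/zeta_Q2.
  - by apply/Q2_Q3/Q1_Q2/R_Q1; exact: R_g.
  - by apply/Q2_Q3/Q1_Q2/R_Q1; exact: R_x.
  - exact: power_span_gen Q2_subalg p_gt0 y_pow.
case=> F QF ->.
have /fin_all_exists2[G QG FG] a : exists2 G : 'I_p -> D, forall b, Q1 (G b) &
    F a = \sum_(b < p) zeta ^+ b * G b by exact: QF.
have /fin_all_exists2[H RH GH] (ab : 'I_p * 'I_p) : exists2 H : 'I_p -> D,
    forall c, H c \in R & G ab.1 ab.2 = \sum_(c < p) v ^+ c * H c.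
  exact: QG.
exists (fun α => H α.1 α.2) => [α|]; first exact: RH.
transitivity (\sum_(ab : 'I_p * 'I_p) \sum_(c < p)
    y ^+ ab.1 * zeta ^+ ab.2 * v ^+ c * H ab c); last by rewrite pair_bigA.
transitivity (\sum_(a < p) \sum_(b < p) \sum_(c < p)
    y ^+ a * zeta ^+ b * v ^+ c * H (a, b) c); last by rewrite pair_bigA; apply: eq_bigr => -[].
apply: eq_bigr => a _; rewrite FG mulr_sumr; apply: eq_bigr => b _.
rewrite (GH (a, b)) !mulr_sumr; apply: eq_bigr => c _.
by rewrite !mulrA.
Qed.
End DoubleSpanning.

(** * The quotient map, its kernel and its coinvariants *)

Lemma mulr_sum3 (A : pzRingType) (n : nat) (F G H : 'I_n -> A) :
  (\sum_i F i) * (\sum_i G i) * (\sum_i H i) =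
  \sum_i \sum_j \sum_l F i * G j * H l.
Proof.
rewrite !mulr_suml; apply: eq_bigr => i _.
rewrite -mulrA mulr_suml mulr_sumr; apply: eq_bigr => j _; rewrite !mulr_sumr.
by apply: eq_bigr => l _; rewrite mulrA.
Qed.

Section QuotientMap.
Variables (k : fieldType) (p : nat).
Hypotheses (p_char : p \in [pchar k]) (p_gt2 : (2 < p)%N).
Variables (D : falgType k) (hD : hopf_structure D) (u v zeta g x y : D).
Hypothesis D_double : is_drinfeld_double p hD u v zeta g x y.
Variables (U : falgType k) (hU : hopf_structure U).
Variable j : {linear subvs_of (sl2 k) -> U}.
Hypothesis U_usl2 : is_restricted_enveloping_sl2 p hU j.
Local Notation R := (double_R u g x).
Local Notation I := ('I_p * 'I_p * 'I_p)%type.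
Local Notation Δ := (comul hD).
Local Notation ε := (counit hD).
Local Notation Y := (usl2_y j).
Local Notation Z := (usl2_zeta j).
Local Notation V := (usl2_v j).
Let rels := double_rel D_double.

Lemma double_quotient : exists φ : {lrmorphism D -> U},
  [/\ φ u = 0, φ v = V & φ zeta = Z] /\ [/\ φ g = 1, φ x = 0 & φ y = Y].
Proof. exact: (double_univ D_double (usl2_double_relations p_char p_gt2 U_usl2)). Qed.

Lemma double_rmorph_ext (T : algType k) (f f' : {lrmorphism D -> T}) :
  [/\ f u = f' u, f v = f' v & f zeta = f' zeta] ->
  [/\ f g = f' g, f x = f' x & f y = f' y] -> f =1 f'.
Proof.
move=> [fu fv fz] [fg fx fy]; apply: (double_ind D_double) => [||s a sX fa].
- split=> [|a b fa fb|c a fa]; first by rewrite !linear0.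
    by rewrite !linearD /= fa fb.
  by rewrite !linearZ /= fa.
- by rewrite !rmorph1.
rewrite !rmorphM /= fa; congr (_ * _).
by move: sX; rewrite !inE => /or4P[/eqP-> | /eqP-> | /eqP-> | /or3P[] /eqP->].
Qed.

Variable φ : {lrmorphism D -> U}.
Hypotheses (φu : φ u = 0) (φv : φ v = V) (φzeta : φ zeta = Z).
Hypotheses (φg : φ g = 1) (φx : φ x = 0) (φy : φ y = Y).

Let usl2_Δ := usl2_primitive U_usl2.

Lemma quotient_comul a : comul hU (φ a) = tmap φ φ (Δ a).
Proof.
have [ΔY ΔZ ΔV] := usl2_Δ.
apply: (double_rmorph_ext (f := comul hU \o φ) (f' := tmap φ φ \o Δ)); split=> /=.
- by rewrite (double_comul_u D_double) !linearD /= !tmapE /= !rmorph1 φu !linear0 pure0l addr0.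
- rewrite (double_comul_v D_double) !linearD /= !tmapE /= !rmorph1 φu φv linear0.
  by rewrite addr0; exact: ΔV.
- by rewrite (double_comul_zeta D_double) !linearD /= !tmapE /= !rmorph1 φzeta ΔZ.
- by rewrite (double_comul_g D_double) !tmapE /= φg rmorph1.
- by rewrite (double_comul_x D_double) !linearD /= !tmapE /= !rmorph1 φx φg !linear0 pure0l addr0.
- by rewrite (double_comul_y D_double) !linearD /= !tmapE /= !rmorph1 φy φg ΔY.
Qed.

Lemma quotient_counit a : counit hU (φ a) = ε a.
Proof.
have [ΔY ΔZ ΔV] := usl2_Δ.
have [εg εx εu] := counit_gxu p_gt2 D_double.
have [εv εz εy] := counit_vzy p_gt2 D_double.
have ε0 := counit_skew_primitive (oner_neq0 U).
apply: (double_rmorph_ext (f := counit hU \o φ) (f' := ε)); split=> /=.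
- by rewrite φu εu linear0.
- by rewrite φv εv ε0.
- by rewrite φzeta εz ε0.
- by rewrite φg εg rmorph1.
- by rewrite φx εx linear0.
- by rewrite φy εy ε0.
Qed.

Lemma quotient_surj b : exists a, φ a = b.
Proof.
have bU : b \in agenv <<[:: Y; Z; V]>>.
  by rewrite (usl2_generated p_char p_gt2 U_usl2) memvf.
move: b bU; apply: agenv_ind => [||s _ sX [a <-]].
- split=> [|_ _ [a <-] [b <-]|c _ [a <-]]; first by exists 0; rewrite linear0.
    by exists (a + b); rewrite linearD.
  by exists (c *: a); rewrite linearZ.
- by exists 1; rewrite rmorph1.
have [t <-] : exists t, φ t = s.
  by move: sX; rewrite !inE => /or3P[] /eqP->; [exists y | exists zeta | exists v].
by exists (t * a); rewrite rmorphM.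
Qed.

Lemma quotient_R r : r \in R -> φ r = (ε r : k)%:A.
Proof.
have [εg εx εu] := counit_gxu p_gt2 D_double.
move: r; apply: R_ind => [|| a aR IHa | a aR IHa | a aR IHa].
- split=> [|a b IHa IHb|c a IHa]; first by rewrite !linear0 scale0r.
    by rewrite !linearD /= IHa IHb scalerDl.
  by rewrite !linearZ /= IHa scalerA.
- by rewrite !rmorph1 scale1r.
- by rewrite !rmorphM /= IHa φg εg !mul1r.
- by rewrite !rmorphM /= IHa φx εx !mul0r scale0r.
- by rewrite !rmorphM /= IHa φu εu !mul0r scale0r.
Qed.

Let mono_D (α : I) : D := y ^+ α.1.1 * zeta ^+ α.1.2 * v ^+ α.2.
Let mono_U (α : I) : U := Y ^+ α.1.1 * Z ^+ α.1.2 * V ^+ α.2.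

Let φ_mono α : φ (mono_D α) = mono_U α.
Proof. by rewrite /mono_D !rmorphM !rmorphXn /= φy φzeta φv. Qed.

(** The quotient map replaces the coefficients in R by their counits and the
    monomials by the independent monomials of U. *)
Lemma quotient_ker (a : D) : φ a = 0 ->
  exists2 r : I -> D, forall α, r α \in R /\ ε (r α) = 0 & a = \sum_α mono_D α * r α.
Proof.
have [r rR ->] := double_span p_gt2 D_double a; rewrite linear_sum => sum0.
exists r => // α; split=> //.
have := usl2_pbw_free p_char p_gt2 U_usl2 (c := fun α => ε (r α)); apply.
rewrite -[RHS]sum0; apply: eq_bigr => β _.
by rewrite -/(mono_D β) rmorphM /= φ_mono quotient_R // -scalerAr mulr1.
Qed.

Local Notation T a := (tmap idfun φ (Δ a)).

(** The generators x and u are killed by φ and g is sent to 1, so the second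
    factor of the coproduct of R becomes trivial. *)
Lemma coaction_R r : r \in R -> T r = r ⊗ 1.
Proof.
move: r; apply: R_ind => [|| a aR IHa | a aR IHa | a aR IHa].
- split=> [|a b IHa IHb|c a IHa]; first by rewrite !linear0 pure0l.
    by rewrite !linearD /= IHa IHb pureDl.
  by rewrite !linearZ /= IHa pureZl.
- by rewrite !rmorph1.
- by rewrite !rmorphM /= IHa (double_comul_g D_double) tmapE /= φg pureM mul1r.
- rewrite !rmorphM /= IHa (double_comul_x D_double) linearD /= !tmapE /= rmorph1 φx.
  by rewrite linear0 addr0 pureM mul1r.
- rewrite !rmorphM /= IHa (double_comul_u D_double) linearD /= !tmapE /= rmorph1 φu.
  by rewrite linear0 addr0 pureM mul1r.
Qed.

Lemma coaction_exp s h σ n N : T s = s ⊗ 1 + h ⊗ σ -> (n < N)%N ->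
  exists d : nat -> D, [/\ d n = h ^+ n, forall i, (n < i)%N -> d i = 0
    & T (s ^+ n) = \sum_(i < N) d i ⊗ (σ ^+ i)].
Proof.
move=> Ts; elim: n N => [|n IHn] [|N] // ltnN.
  exists (fun i => if i is 0 then 1 else 0); split=> //; first by case.
  rewrite !rmorph1 big_ord_recl big1 ?addr0 // => i _; exact: pure0l.
have [d [dn dgt Tn]] := IHn N ltnN.
exists (fun i => s * d i + (if i is i'.+1 then h * d i' else 0)); split.
- by rewrite dgt // mulr0 add0r dn exprS.
- by case=> // i lti; rewrite !dgt ?mulr0 ?addr0 // ltnW.
rewrite exprS !rmorphM /= Ts Tn mulrDl !mulr_sumr.
under [RHS]eq_bigr do rewrite pureDl.
rewrite big_split /=; congr (_ + _).
  rewrite [RHS]big_ord_recr /= [d N]dgt ?mulr0 ?pure0l ?addr0 //.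
  by apply: eq_bigr => i _; rewrite pureM mul1r.
rewrite [RHS]big_ord_recl pure0l add0r.
by apply: eq_bigr => i _; rewrite pureM exprS.
Qed.

(** The top term of the coaction arises by choosing g ⊗ y in each factor y, and
    1 ⊗ zeta, 1 ⊗ v in the others. *)
Lemma coaction_mono (α : I) : exists d : I -> D,
  [/\ d α = g ^+ α.1.1,
      forall β : I, [|| α.1.1 < β.1.1, α.1.2 < β.1.2 | α.2 < β.2]%N -> d β = 0
    & T (mono_D α) = \sum_β d β ⊗ mono_U β].
Proof.
have Ty : T y = y ⊗ 1 + g ⊗ Y.
  by rewrite (double_comul_y D_double) linearD /= !tmapE /= rmorph1 φy.
have Tz : T zeta = zeta ⊗ 1 + 1 ⊗ Z.
  by rewrite (double_comul_zeta D_double) linearD /= !tmapE /= rmorph1 φzeta.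
have Tv : T v = v ⊗ 1 + 1 ⊗ V.
  by rewrite (double_comul_v D_double) !linearD /= !tmapE /= rmorph1 φv φu linear0 addr0.
have [dy [dya dy0 Tya]] := coaction_exp Ty (ltn_ord α.1.1).
have [dz [dza dz0 Tza]] := coaction_exp Tz (ltn_ord α.1.2).
have [dv [dva dv0 Tva]] := coaction_exp Tv (ltn_ord α.2).
exists (fun β : I => dy β.1.1 * dz β.1.2 * dv β.2); split.
- by rewrite dya dza dva !expr1n !mulr1.
- by move=> β /or3P[] ltβ; rewrite ?(dy0 _ ltβ) ?(dz0 _ ltβ) ?(dv0 _ ltβ) ?mulr0 ?mul0r.
rewrite /mono_D !rmorphM /= Tya Tza Tva.
transitivity (\sum_(ij : 'I_p * 'I_p) \sum_(l < p)
    (dy ij.1 * dz ij.2 * dv l) ⊗ (Y ^+ ij.1 * Z ^+ ij.2 * V ^+ l)); last by rewrite pair_bigA.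
transitivity (\sum_(i < p) \sum_(j < p) \sum_(l < p)
    (dy i * dz j * dv l) ⊗ (Y ^+ i * Z ^+ j * V ^+ l)); last first.
  by rewrite pair_bigA; apply: eq_bigr => -[].
rewrite mulr_sum3; apply: eq_bigr => i _; apply: eq_bigr => l _.
by apply: eq_bigr => m _; rewrite !pureM.
Qed.

(** If a = Σ m_α r_α is coinvariant, then only m_0 = 1 may occur in the second
    factor of its coaction. For α ≠ 0 of maximal degree with r_α ≠ 0, the coefficient
    of m_α is g^i r_α with g invertible, so r_α = 0. *)
Lemma coinvariant_R a : T a = a ⊗ 1 -> a \in R.
Proof.
have p_gt0 : (0 < p)%N by apply: leq_trans p_gt2.
have [r rR aE] := double_span p_gt2 D_double a => Ta.
have /fin_all_exists[d dP] := coaction_mono.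
pose o : I := (Ordinal p_gt0, Ordinal p_gt0, Ordinal p_gt0).
have TM w s : s \in R -> T (w * s) = T w * (s ⊗ 1).
  by move=> sR; rewrite -(coaction_R sR) !rmorphM.
have mono_o : mono_U o = 1 by rewrite /mono_U !mulr1.
have coeff0 β : \sum_α d α β * r α - (if β == o then a else 0) = 0.
  move: β; apply: (tensor_indep (m := mono_U)).
    exact: (usl2_pbw_free p_char p_gt2 U_usl2).
  under eq_bigr do rewrite pureDl.
  rewrite big_split /=; apply/eqP.
  have -> : \sum_β (- (if β == o then a else 0)) ⊗ mono_U β = - (a ⊗ 1).
    rewrite (bigD1 o) // eqxx mono_o pureNl big1 => [|β /negPf->]; first exact: addr0.
    by rewrite oppr0 pure0l.
  rewrite subr_eq0 -Ta aE !linear_sum /=; apply/eqP.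
  under eq_bigr do rewrite pure_suml.
  rewrite exchange_big; apply: eq_bigr => α _; rewrite -/(mono_D α) TM //.
  have [_ _ ->] := dP α.
  by rewrite mulr_suml; apply: eq_bigr => β _; rewrite pureM mulr1.
have r0 α : α != o -> r α = 0.
  move=> αo; apply/eqP/negPn/negP => rα.
  pose P β := (β != o) && (r β != 0).
  have Pα : P α by rewrite /P αo.
  case: (arg_maxnP (P := P) (fun β : I => (β.1.1 + β.1.2 + β.2)%N) Pα) => {αo rα Pα}α.
  move=> /andP[αo rα] α_max; have := coeff0 α; rewrite (negPf αo) subr0 (bigD1 α) //=.
  rewrite big1 => [|β βα].
    have [-> _ _] := dP α; rewrite addr0 => /(congr1 ( *%R (g ^+ α.1.1)^-1)).
    by rewrite mulr0 mulKr ?unitrX ?(double_g_unit p_gt2 D_double) // => r0; rewrite r0 eqxx in rα.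
  have [_ d0 _] := dP β.
  have [lt | ] := boolP [|| β.1.1 < α.1.1, β.1.2 < α.1.2 | β.2 < α.2]%N.
    by rewrite d0 // mul0r.
  rewrite !negb_or -!leqNgt => /and3P[le1 le2 le3].
  have βα_size : ((α.1.1 + α.1.2 + α.2) < (β.1.1 + β.1.2 + β.2))%N.
    rewrite ltn_neqAle !leq_add // andbT; apply: contraNneq βα => sz.
    have [_ e3] := leqif_add (leqif_add (leqif_eq le1) (leqif_eq le2)) (leqif_eq le3).
    move: e3; rewrite sz eqxx => /esym/andP[/andP[/eqP/val_inj e1 /eqP/val_inj e2] /eqP/val_inj e3].
    by rewrite [β]surjective_pairing [β.1]surjective_pairing -e1 -e2 -e3 -!surjective_pairing.
  have [-> | rβ] := eqVneq (r β) 0; first by rewrite mulr0.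
  have βo : β != o.
    by apply: contraTneq βα_size => ->.
  have Pβ : P β by rewrite /P βo.
  by have := α_max β Pβ; rewrite /= leqNgt βα_size.
rewrite aE (bigD1 o) //= !mulr1 mul1r big1 ?addr0 ?rR // => α αo.
by rewrite r0 // mulr0.
Qed.
End QuotientMap.

Theorem proposition1p9 (k : closedFieldType) (p : nat)
    (p_char : p \in [pchar k]) (p_gt2 : (2 < p)%N)
    (D : falgType k) (hD : hopf_structure D) (u v zeta g x y : D)
    (D_double : is_drinfeld_double p hD u v zeta g x y)
    (U : falgType k) (hU : hopf_structure U)
    (j : {linear subvs_of (sl2 k) -> U})
    (U_usl2 : is_restricted_enveloping_sl2 p hU j) :
  let R : {aspace D} := agenv_aspace <<[:: g; x; u]>> in
  [/\ is_hopf_subalgebra hD R,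
      is_normal hD R,
      is_local (subvs_of R),
      \dim R = (p ^ 3)%N
    & truncated_presentation p (vsproj R g) (vsproj R x) (vsproj R u)] /\
  exists (hR : hopf_structure (subvs_of R)) (pi : 'Hom(D, U)),
    exact_sequence hR hD hU (linfun (vsval : subvs_of R -> D)) pi.
Proof.
move=> R; have R_sub := R_hopf p_gt2 D_double; split.
  split; [exact: R_sub | exact: (R_normal p_gt2 D_double) | | |].
  - exact: (R_local p_char p_gt2 D_double).
  - exact: (R_dim p_char p_gt2 D_double).
  - exact: (R_presentation p_char p_gt2 D_double).
have [φ [[φu φv φz] [φg φx φy]]] := double_quotient p_char p_gt2 D_double U_usl2.
have φR := quotient_R p_gt2 D_double φu φg φx.
have incl_img : limg (linfun (vsval : subvs_of R -> D)) = R.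
  apply/vspaceP=> a; apply/idP/idP => [/memv_imgP[r _ ->] | aR].
    by rewrite lfunE subvsP.
  by rewrite -[a](vsprojK aR) -[vsval _](lfunE (vsval : {linear subvs_of R -> D})) memv_img ?memvf.
exists (sub_hopf R_sub), (linfun φ); split.
- exact: sub_hopf_incl.
- split=> [|a b|a|a]; rewrite ?lfunE /=.
  + exact: rmorph1.
  + exact: rmorphM.
  + rewrite (quotient_comul D_double U_usl2 φu φv φz φg φx φy).
    by apply: eq_tmap => b; rewrite lfunE.
  + exact: (quotient_counit p_gt2 D_double U_usl2 φu φv φz φg φx φy).
- by move=> a b; rewrite !lfunE; exact: subvs_inj.
- move=> b; have [a <-] := quotient_surj p_char p_gt2 U_usl2 φv φz φy b.
  by exists a; rewrite lfunE.
- apply/eqP; rewrite eqEsubv; apply/andP; split.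
    apply/subvP=> a; rewrite memv_ker lfunE => /eqP φa.
    have [r rR ->] := quotient_ker p_char p_gt2 D_double U_usl2 φu φv φz φg φx φy φa.
    rewrite memv_suml // => α _; have [rαR εrα] := rR α.
    rewrite memv_mul ?memvf // -[r α](vsprojK rαR).
    rewrite -[vsval _](lfunE (vsval : {linear subvs_of R -> D})) memv_img // memv_ker lfunE /=.
    by rewrite vsprojK // εrα.
  apply/prodvP=> a b _ /memv_imgP[r]; rewrite memv_ker lfunE /= => /eqP εr ->.
  by rewrite memv_ker !lfunE rmorphM /= (φR _ (subvsP r)) εr scale0r mulr0.
- move=> c; rewrite incl_img /is_coinvariant.
  have -> : tmap idfun (linfun φ) (comul hD c) = tmap idfun φ (comul hD c).
    by apply: eq_tmap => // a; rewrite lfunE.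
  split; first exact: (coaction_R D_double φu φg φx).
  exact: (coinvariant_R p_char p_gt2 D_double U_usl2 φu φv φz φg φx φy).
Qed.
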